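(* Let $L/K$ be a small extension of algebraically closed analytic fields and let $F$ be an intermediate algebraically closed analytic field, $K\subseteq F\subseteq L$. Then $L$ and $F$ are isomorphic as analytic $K$-fields if and only if the inequality $\mathrm{tr.c}(F/K)\le \mathrm{tr.c}(L/K)$ is an equality. In addition, in this case the extension $L/F$ is immediate.
   Context: An analytic field is a field complete with respect to a real-valued (rank at most one, possibly trivial) multiplicative non-archimedean absolute value $|\ |$. An extension of analytic fields is a field extension in which the absolute value of the larger field restricts to that of the smaller one; isomorphisms of analytic $K$-fields are isometric $K$-isomorphisms. For a valued field $K$, $K^a$ denotes an algebraic closure with the extended absolute value, and $\widehat{\ \cdot\ }$ denotes completion. For an extension $L/K$ of analytic fields and a subset $S\subset L$, $\widehat{K(S)^a}$ denotes the closure in $\widehat{L^a}$ of the algebraic closure of $K(S)$. A set $S\subset L$ is t.a. (topologically-algebraically) independent over $K$ if $\widehat{K(S')^a}\subsetneq\widehat{K(S)^a}$ for any $S'\subsetneq S$, and it is t.a. generating for $L/K$ if $\widehat{L^a}=\widehat{K(S)^a}$. The topological generating degree $\mathrm{Tr.c}(L/K)$ is the minimum of the cardinalities of t.a. generating sets of $L/K$, and the topological transcendence degree $\mathrm{tr.c}(L/K)$ is the supremum of the cardinalities of subsets of $L$ that are t.a. independent over $K$. The extension is called small if $\mathrm{Tr.c}(L/K)$ is finite. An extension $L/F$ of analytic fields is immediate if it induces equalities of residue fields $\widetilde L=\widetilde F$ and of value groups $|L^\times|=|F^\times|$. *)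

(* Defs.v *)
From HB Require Import structures.
From mathcomp Require Import all_boot all_order all_algebra.
From mathcomp Require Import all_classical all_reals.

Set Implicit Arguments.
Unset Strict Implicit.
Unset Printing Implicit Defensive.

Import Order.TTheory GRing.Theory Num.Theory.
Local Open Scope classical_set_scope.
Local Open Scope ring_scope.
Local Open Scope card_scope.

(* A cardinal is represented by a set having that cardinality, and cardinals
   are compared with #<= and #=. *)
Section Cardinals.
Variable T : Type.
Implicit Types (A : set (set T)) (S U : set T).

Lemma card_wf A : A !=set0 -> exists2 S, A S & forall S', A S' -> S #<= S'.
Proof.
move=> [S0 AS0].
(* Zorn on sets of functions g whose values g S lie in S and whose distinct
   members differ at every S in A. *)
pose P (G : set (set T -> T)) :=
  (forall g, G g -> forall S, A S -> S (g S)) /\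
  (forall g h S, G g -> G h -> A S -> g S = h S -> g = h).
have [F FP Ftot|G [[GS Ginj] Gmax]] := @Zorn_bigcup _ P.
  split=> [g [X FX Xg] S AS|g h S [X FX Xg] [Y FY Yh] AS gh].
    by have [/(_ g Xg S AS)] := FP X FX.
  have [XY|YX] := Ftot X Y FX FY.
    by have [_] := FP Y FY; apply; [exact: XY|exact: Yh|exact: AS|].
  by have [_] := FP X FX; apply; [exact: Xg|exact: YX|exact: AS|].
have [S AS Sonto] : exists2 S, A S & forall x, S x -> exists2 g, G g & g S = x.
  apply: contrapT => nS.
  have miss S : exists x, A S -> S x /\ (forall g, G g -> g S <> x).
    have [AS|nAS] := pselect (A S); last first.
      have [x _] : exists x : T, True.
        apply: contrapT => nT; apply: nS; exists S0 => // x.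
        by case: nT; exists x.
      by exists x.
    apply: contrapT => nx; apply: nS; exists S => // x Sx.
    apply: contrapT => ng; apply: nx; exists x => _; split=> // g Gg gS.
    by apply: ng; exists g.
  have [k kP] := choice miss.
  have nGk : ~ G k by move=> Gk; have [_ /(_ k Gk)] := kP S0 AS0.
  apply: (Gmax (G `|` [set k])).
    split=> [g Gg|GkG]; first by left.
    by apply: nGk; apply: GkG; right.
  split=> [g [/GS gS|->] S AS|g h S [Gg|->] [Gh|->] AS // gh].
  - exact: gS.
  - by have [] := kP S AS.
  - exact: Ginj Gg Gh AS gh.
  - by have [_ /(_ g Gg)] := kP S AS.
  - by have [_ /(_ h Gh)] := kP S AS; rewrite gh.
exists S => // S' AS'.
have pick x : exists g, S x -> G g /\ g S = x.
  have [Sx|nSx] := pselect (S x); last by exists (fun=> x).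
  by have [g Gg gS] := Sonto x Sx; exists g.
have [k kP] := choice pick.
pose f x := k x S'.
have fS x : S x -> S' (f x) by move=> /kP[/GS/(_ _ AS')].
have finj : {in S &, injective f}.
  move=> x y /set_mem Sx /set_mem Sy fxy.
  have [Gx <-] := kP x Sx; have [Gy <-] := kP y Sy.
  by rewrite (Ginj _ _ _ Gx Gy AS' fxy).
have fimg : f @` S `<=` S' by move=> _ [x Sx <-]; exact: fS.
rewrite (card_le_trans _ (subset_card_le fimg))//.
by rewrite (card_le_eqr (inj_card_eq finj)).
Qed.

Definition card_min A : set T :=
  xget setT [set S | A S /\ forall S', A S' -> S #<= S'].

Lemma card_minP A : A !=set0 ->
  A (card_min A) /\ forall S, A S -> card_min A #<= S.
Proof.
move=> /card_wf[S AS minS].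
exact: (@xgetI _ setT [set S | A S /\ forall S', A S' -> S #<= S'] S).
Qed.

(* The bounds range over subsets of T only, which is no restriction since all
   the members of A do. *)
Definition card_sup A : set T := card_min [set U | forall S, A S -> S #<= U].

Lemma card_supP A : (forall S, A S -> S #<= card_sup A) /\
  forall U, (forall S, A S -> S #<= U) -> card_sup A #<= U.
Proof.
by apply: card_minP; exists setT => S _; exact: card_leT.
Qed.

End Cardinals.

(* All fields live inside one fieldType Omega, which is meant to be an
   algebraically closed analytic field for the absolute value v.  Hence, for a
   subfield A of Omega, the algebraic closure A^a and its completion are the
   set of elements of Omega algebraic over A and its v-closure in Omega. *)
Section AnalyticFields.
Variables (R : realType) (Omega : fieldType) (v : Omega -> R).
Implicit Types (A B K L S : set Omega).

Definition nonarch_absval :=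
  [/\ forall x, 0 <= v x,
      forall x, v x = 0 <-> x = 0,
      forall x y, v (x * y) = v x * v y &
      forall x y, v (x + y) <= Num.max (v x) (v y)].

Definition subfield A := divring_closed (mem A).

Definition complete_in A := forall u : nat -> Omega,
  (forall n, A (u n)) ->
  (forall e : R, 0 < e -> exists N, forall m n,
     (N <= m)%N -> (N <= n)%N -> v (u m - u n) < e) ->
  exists2 l, A l & forall e : R, 0 < e -> exists N, forall n,
     (N <= n)%N -> v (u n - l) < e.

Definition analytic A := subfield A /\ complete_in A.

Definition alg_closed A := forall p : {poly Omega},
  p \is a polyOver (mem A) -> (1 < size p)%N -> exists2 x, A x & root p x.

Definition adjoin K S : set Omega := smallest subfield (K `|` S).

Definition alg_closure A : set Omega := [set x | exists p : {poly Omega},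
  [/\ p \is a polyOver (mem A), p != 0 & root p x]].

Definition v_closure A : set Omega :=
  [set x | forall e : R, 0 < e -> exists2 a, A a & v (x - a) < e].

Definition completed_alg_closure A : set Omega := v_closure (alg_closure A).

(* For K and S contained in a subfield L, the closure of K(S)^a in the
   completion of L^a is its closure in Omega, and does not depend on L. *)
Definition ta_closure K S : set Omega := completed_alg_closure (adjoin K S).

Definition ta_independent K S :=
  forall S', S' `<` S -> ta_closure K S' `<` ta_closure K S.

Definition ta_generating K L S :=
  S `<=` L /\ completed_alg_closure L = ta_closure K S.

(* Tr.c(L/K) *)
Definition top_gen_degree K L : set Omega :=
  card_min [set S | ta_generating K L S].

(* tr.c(L/K) *)
Definition top_tr_degree K L : set Omega :=
  card_sup [set S | S `<=` L /\ ta_independent K S].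

Definition small_ext K L := finite_set (top_gen_degree K L).

Definition analytic_isomorphic K A B := exists f : Omega -> Omega,
  [/\ set_bij A B f,
      {in A &, {morph f : x y / x + y}},
      {in A &, {morph f : x y / x * y}},
      {in K, forall x, f x = x} &
      {in A, forall x, v (f x) = v x}].

(* The class of x modulo the maximal ideal of the ring of integers of Omega is
   the open unit ball around x; thus the residue field of A is identified with
   its image in the residue field of Omega. *)
Definition residue_field A : set (set Omega) :=
  [set [set y | v (y - x) < 1] | x in [set x | A x /\ v x <= 1]].

Definition value_group A : set R := [set v x | x in A `\ 0].

Definition immediate_ext F L :=
  residue_field L = residue_field F /\ value_group L = value_group F.

End AnalyticFields.

(* Main.v *)
(* Write cl S for the completed algebraic closure of K(S) in L.

   Two facts on approximation are used.  First, if y lies outside the complete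
   algebraically closed field M = cl T and z is closer to y than M is, then
   |f(y)| = |f(z)| for every polynomial f over M; hence cl (T, y) and cl (T, z) are
   isometric over M, and replacing y by z preserves topological independence.
   Moving an independent family y_1, ..., y_m of L = cl (x_1, ..., x_n) in this way
   into the algebraic closure of K(x_1, ..., x_n), one obtains from the algebraic
   exchange lemma that m <= n and, if m = n, that cl (y_1, ..., y_n) is isomorphic
   to L.  Second, let E be a complete algebraically closed subfield of F, and x an
   element of L whose powers have the same distances to the spans of the lower
   ones over E as over F.  Then an element of F at distance s from E is at distance
   at least s from every element algebraic over E(x), and similarly for several x
   and their monomials.

   Suppose now that F contains an independent family y_1, ..., y_n with n = tr.c(L/K).
   If u in L had no approximation c in F with |u - c| < |u|, the second fact, with E
   generated by all the y_j but y_i, would show that u, y_1, ..., y_n is independent;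
   so L/F is immediate.  Applied to the monomials in a generating family of L, the
   second fact also shows that F = cl Z for a countable Z, namely the coefficients of
   almost best approximations over F.  So F is the closure of the union of an increasing
   sequence of fields generated by n elements, and a limit of suitably perturbed
   generators of these fields generates F.  By the first fact, F is isomorphic to L. *)

From HB Require Import structures.
Require Import Defs.
From mathcomp Require Import finmap.
From mathcomp Require Import all_boot all_order all_algebra.
From mathcomp Require Import all_classical all_reals.
From mathcomp Require Import ring lra.

Set Implicit Arguments.
Unset Strict Implicit.
Unset Printing Implicit Defensive.

Import Order.TTheory GRing.Theory Num.Theory.
Local Open Scope classical_set_scope.
Local Open Scope ring_scope.
Local Open Scope card_scope.

(** * Absolute values and subfields *)

(** Bundles the hypotheses on the ambient field. Being complete and algebraically closed, it serves
    as its own completed algebraic closure, so all closures are taken inside it. *)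
Record acfield (R : realType) := ACField {
  ac_field :> fieldType;
  absv : ac_field -> R;
  ac_absval : nonarch_absval absv;
  ac_complete : complete_in absv [set: ac_field];
  ac_closed : alg_closed [set: ac_field] }.

Section AbsoluteValue.
Variables (R : realType) (L : acfield R).
Implicit Types (x y : L) (r : R).
Local Notation v := (@absv R L).

Lemma v_ge0 x : 0 <= v x.
Proof. by have [] := ac_absval L. Qed.

Lemma v_eq0 x : (v x == 0) = (x == 0).
Proof. by have [_ v0 _ _] := ac_absval L; apply/eqP/eqP => /v0. Qed.

Lemma v0 : v 0 = 0.
Proof. by apply/eqP; rewrite v_eq0. Qed.

Lemma v_gt0 x : (0 < v x) = (x != 0).
Proof. by rewrite lt0r v_eq0 v_ge0 andbT. Qed.

Lemma vM x y : v (x * y) = v x * v y.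
Proof. by have [] := ac_absval L. Qed.

Lemma vD_max x y : v (x + y) <= Num.max (v x) (v y).
Proof. by have [] := ac_absval L. Qed.

Lemma vD_le r x y : v x <= r -> v y <= r -> v (x + y) <= r.
Proof. by move=> xr yr; apply: le_trans (vD_max x y) _; rewrite ge_max xr. Qed.

Lemma vD_lt r x y : v x < r -> v y < r -> v (x + y) < r.
Proof. by move=> xr yr; apply: le_lt_trans (vD_max x y) _; rewrite gt_max xr. Qed.

Lemma v1 : v 1 = 1.
Proof.
have n0 : v 1 != 0 by rewrite v_eq0 oner_eq0.
by apply: (mulfI n0); rewrite -vM !mulr1.
Qed.

Lemma vN x : v (- x) = v x.
Proof.
have /eqP : v (- 1) ^+ 2 = 1 by rewrite expr2 -vM mulrNN mulr1 v1.
rewrite sqrp_eq1 ?v_ge0// => /eqP vN1.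
by rewrite -mulN1r vM vN1 mul1r.
Qed.

Lemma vB_le r x y : v x <= r -> v y <= r -> v (x - y) <= r.
Proof. by move=> xr yr; rewrite vD_le ?vN. Qed.

Lemma vB_lt r x y : v x < r -> v y < r -> v (x - y) < r.
Proof. by move=> xr yr; rewrite vD_lt ?vN. Qed.

Lemma vBC x y : v (x - y) = v (y - x).
Proof. by rewrite -vN opprB. Qed.

Lemma vV x : v x^-1 = (v x)^-1.
Proof.
have [->|x0] := eqVneq x 0; first by rewrite invr0 v0 invr0.
have vx0 : v x != 0 by rewrite v_eq0.
by apply: (mulfI vx0); rewrite -vM !divff// v1.
Qed.

Lemma vX x n : v (x ^+ n) = v x ^+ n.
Proof. by elim: n => [|n IH]; rewrite ?expr0 ?v1// !exprS vM IH. Qed.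

Lemma v_sum_lt (I : Type) (s : seq I) (P : pred I) (f : I -> L) r :
  0 < r -> (forall i, P i -> v (f i) < r) -> v (\sum_(i <- s | P i) f i) < r.
Proof.
move=> r0 fr; apply: (big_ind (fun x => v x < r)) => //; first by rewrite v0.
by move=> x y; apply: vD_lt.
Qed.

(** If x + y were smaller than y, then so would be y = (x + y) - x. *)
Lemma vD_dom x y : v x < v y -> v (x + y) = v y.
Proof.
move=> xy; apply/eqP; rewrite eq_le vD_le ?(ltW xy)//=.
rewrite leNgt; apply/negP => h.
have : v (x + y - x) < v y by rewrite vB_lt.
by rewrite addrC addKr ltxx.
Qed.

Lemma vB_dom x y : v x < v y -> v (y - x) = v y.
Proof. by move=> xy; rewrite addrC vD_dom ?vN. Qed.

Lemma v_close x y z : v (x - y) < v (y - z) -> v (x - z) = v (y - z).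
Proof. by move=> h; rewrite -(vD_dom h) addrA subrK. Qed.

Lemma vB_trans_lt r y x z : v (x - y) < r -> v (y - z) < r -> v (x - z) < r.
Proof. by move=> xy yz; rewrite -(subrK y x) -addrA vD_lt. Qed.

End AbsoluteValue.

Section SubfieldTheory.
Variable L : fieldType.
Implicit Types (A B S : set L) (x y : L) (p q : {poly L}).

(** A pointwise substitute for [polyOver], whose closure lemmas would require a canonical subring
    structure on the set A. *)
Definition coefs_in A p := forall i, A p`_i.

Lemma subfieldP A : subfield A <->
  [/\ A 1, forall x y, A x -> A y -> A (x - y) &
      forall x y, A x -> A y -> A (x / y)].
Proof.
split=> -[A1 AB AV]; split.
- exact/set_mem/A1.
- by move=> x y Ax Ay; apply/set_mem/AB; apply/mem_set.
- by move=> x y Ax Ay; apply/set_mem/AV; apply/mem_set.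
- exact/mem_set.
- by move=> x y /set_mem Ax /set_mem Ay; apply/mem_set/AB.
- by move=> x y /set_mem Ax /set_mem Ay; apply/mem_set/AV.
Qed.

Section Closure.
Variables (A : set L) (sA : subfield A).

Lemma sf1 : A 1. Proof. by have /subfieldP[] := sA. Qed.
Lemma sfB x y : A x -> A y -> A (x - y).
Proof. by have /subfieldP[_ AB _] := sA; apply: AB. Qed.
Lemma sfdiv x y : A x -> A y -> A (x / y).
Proof. by have /subfieldP[_ _ AV] := sA; apply: AV. Qed.
Lemma sf0 : A 0. Proof. by rewrite -(subrr 1); exact: sfB sf1 sf1. Qed.
Lemma sfN x : A x -> A (- x).
Proof. by move=> Ax; rewrite -(sub0r x); exact: sfB sf0 Ax. Qed.
Lemma sfD x y : A x -> A y -> A (x + y).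
Proof. by move=> Ax Ay; rewrite -(opprK y); apply: sfB => //; exact: sfN. Qed.
Lemma sfV x : A x -> A x^-1.
Proof. by move=> Ax; rewrite -(mul1r x^-1); exact: sfdiv sf1 Ax. Qed.
Lemma sfM x y : A x -> A y -> A (x * y).
Proof. by move=> Ax Ay; rewrite -(invrK y); apply: sfdiv => //; exact: sfV. Qed.
Lemma sfX x n : A x -> A (x ^+ n).
Proof.
by move=> Ax; elim: n => [|n IH]; rewrite ?expr0 ?exprS; [exact: sf1|exact: sfM].
Qed.
Lemma sf_sum (I : Type) (s : seq I) (P : pred I) (f : I -> L) :
  (forall i, P i -> A (f i)) -> A (\sum_(i <- s | P i) f i).
Proof. by move=> fA; apply: (big_ind A) => //; [exact: sf0|exact: sfD]. Qed.

Lemma coefs_inC x : A x -> coefs_in A x%:P.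
Proof. by move=> Ax i; rewrite coefC; case: ifP => // _; exact: sf0. Qed.
Lemma coefs_inX : coefs_in A 'X.
Proof. by move=> i; rewrite coefX; case: (i == 1)%N; [exact: sf1|exact: sf0]. Qed.
Lemma coefs_inD p q : coefs_in A p -> coefs_in A q -> coefs_in A (p + q).
Proof. by move=> pA qA i; rewrite coefD; exact: sfD. Qed.
Lemma coefs_inN p : coefs_in A p -> coefs_in A (- p).
Proof. by move=> pA i; rewrite coefN; exact: sfN. Qed.
Lemma coefs_inB p q : coefs_in A p -> coefs_in A q -> coefs_in A (p - q).
Proof. by move=> pA qA; apply: coefs_inD => //; exact: coefs_inN. Qed.
Lemma coefs_inM p q : coefs_in A p -> coefs_in A q -> coefs_in A (p * q).
Proof. by move=> pA qA i; rewrite coefM; apply: sf_sum => j _; exact: sfM. Qed.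
Lemma coefs_inZ x p : A x -> coefs_in A p -> coefs_in A (x *: p).
Proof. by move=> Ax pA i; rewrite coefZ; exact: sfM. Qed.
Lemma coefs_in_sum (I : Type) (s : seq I) (P : pred I) (f : I -> {poly L}) :
  (forall i, P i -> coefs_in A (f i)) -> coefs_in A (\sum_(i <- s | P i) f i).
Proof. by move=> fA i; rewrite coef_sum; apply: sf_sum => j Pj; exact: fA. Qed.
Lemma sf_horner p x : coefs_in A p -> A x -> A p.[x].
Proof.
by move=> pA Ax; rewrite horner_coef; apply: sf_sum => i _; apply: sfM => //; exact: sfX.
Qed.
Lemma coefs_in_comp p q : coefs_in A p -> coefs_in A q -> coefs_in A (p \Po q).
Proof.
move=> pA qA; elim/poly_ind: p pA => [|p c IH] pA.
  by rewrite comp_poly0 => i; rewrite coef0; exact: sf0.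
have cA : A c by have := pA 0; rewrite coefD coefMX coefC add0r.
have {}pA : coefs_in A p.
  by move=> i; have := pA i.+1; rewrite coefD coefMX coefC addr0.
rewrite comp_poly_MXaddC; apply: coefs_inD; last exact: coefs_inC.
by apply: coefs_inM => //; exact: IH.
Qed.

(** Comparing coefficients gives q_i = (q (X - x))_(i+1) + x q_(i+1); descend from the degree of
    q. *)
Lemma coefs_in_factor q x :
  A x -> coefs_in A (q * ('X - x%:P)) -> coefs_in A q.
Proof.
move=> Ax qA.
have qS i : q`_i = (q * ('X - x%:P))`_i.+1 + x * q`_i.+1.
  by rewrite mulrBr coefB coefMX coefMC /= mulrC subrK.
have main k : forall i, (size q <= i + k)%N -> A q`_i.
  elim: k => [|k IH] i; first by rewrite addn0 => h; rewrite nth_default //; exact: sf0.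
  rewrite addnS -addSn => /IH qi; rewrite qS.
  by apply: sfD => //; exact: sfM.
by move=> i; apply: (main (size q)); rewrite leq_addl.
Qed.

End Closure.

Lemma polyOver_coefs A p : subfield A -> p \is a polyOver (mem A) <-> coefs_in A p.
Proof.
move=> sA; rewrite qualifE; split=> [/allP pA i|pA].
  have [ip|ip] := ltnP i (size p); first exact/set_mem/pA/mem_nth.
  by rewrite nth_default//; exact: sf0.
by apply/allP => _ /(nthP 0)[i _ <-]; apply/mem_set/pA.
Qed.

(** The hypothesis [alg_closed] yields some root in A, not necessarily x; divide it out and repeat
    until x itself appears. *)
Lemma alg_closure_closed A : subfield A -> alg_closed A -> alg_closure A `<=` A.
Proof.
move=> sA cA x [p [/(polyOver_coefs p sA) pA p0 px]].
have [n] := ubnP (size p); elim: n p pA p0 px => // n IH p pA p0 px szp.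
have szp1 : (1 < size p)%N by exact: root_size_gt1 px.
have [y Ay /factor_theorem[q pq]] := cA p ((polyOver_coefs p sA).2 pA) szp1.
rewrite pq in pA p0 px szp.
have q0 : q != 0 by apply: contraNneq p0 => ->; rewrite mul0r.
move: px; rewrite rootM root_XsubC => /orP[qx|/eqP->//].
apply: (IH q) => //; first exact: coefs_in_factor pA.
by move: szp; rewrite size_Mmonic ?monicXsubC// size_XsubC addn2.
Qed.

Lemma sub_alg_closure A : subfield A -> A `<=` alg_closure A.
Proof.
move=> sA x Ax; exists ('X - x%:P); split; last by rewrite root_XsubC.
  apply/(polyOver_coefs _ sA); apply: (coefs_inB sA); first exact: (coefs_inX sA).
  exact: (coefs_inC sA).
by rewrite polyXsubC_eq0.
Qed.

Lemma alg_closureS A B : A `<=` B -> alg_closure A `<=` alg_closure B.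
Proof.
move=> AB x [p [pA p0 px]]; exists p; split => //.
move: pA; rewrite !qualifE; apply: sub_all => y /set_mem Ay.
exact/mem_set/AB.
Qed.

End SubfieldTheory.

(** Turns a set that is a subfield into a [fieldType] with an inclusion morphism, so that the theory
    of [algebraicOver] and of integral elements applies to [alg_closure]. *)
Record subfield_of (L : fieldType) :=
  SubfieldOf { subfield_set : set L; subfield_setP : subfield subfield_set }.

Definition subfield_pred (L : fieldType) (A : subfield_of L) : {pred L} :=
  mem (subfield_set A).

HB.instance Definition _ (L : fieldType) (A : subfield_of L) :=
  GRing.isDivringClosed.Build L (subfield_pred A) (subfield_setP A).

Record subfield_type (L : fieldType) (A : subfield_of L) :=
  SubfieldElt { subfield_val : L; _ : subfield_val \in subfield_pred A }.

HB.instance Definition _ (L : fieldType) (A : subfield_of L) :=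
  [isSub for (@subfield_val L A)].
HB.instance Definition _ (L : fieldType) (A : subfield_of L) :=
  [Choice of subfield_type A by <:].
HB.instance Definition _ (L : fieldType) (A : subfield_of L) :=
  [SubChoice_isSubIntegralDomain of subfield_type A by <:].
HB.instance Definition _ (L : fieldType) (A : subfield_of L) :=
  [SubIntegralDomain_isSubField of subfield_type A by <:].

Definition subfield_incl (L : fieldType) (A : subfield_of L) :
  {rmorphism subfield_type A -> L} := \val.

Section AlgebraicClosure.
Variable L : fieldType.
Implicit Types (A B S : set L) (x y : L) (p q : {poly L}).

Lemma alg_closureE (A : subfield_of L) x :
  alg_closure (subfield_set A) x <->
  algebraicOver (@subfield_incl L A) x.
Proof.
split=> [[p [/(polyOver_coefs _ (subfield_setP A)) pA p0 px]]|[q q0 qx]].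
  have pA' i : p`_i \in subfield_pred A by apply/mem_set/pA.
  exists (\poly_(i < size p) SubfieldElt (pA' i)).
    apply: contraNneq p0 => /polyP q0; apply/eqP/polyP => i.
    rewrite coef0; have [ip|ip] := ltnP i (size p); last by rewrite nth_default.
    by have := q0 i; rewrite coef_poly ip coef0 => /(congr1 (@subfield_val L A)).
  rewrite (_ : map_poly _ _ = p)//; apply/polyP => i.
  rewrite coef_map coef_poly; case: ltnP => [//|ip].
  by rewrite nth_default// rmorph0.
exists (map_poly (@subfield_incl L A) q); split => //.
  apply/(polyOver_coefs _ (subfield_setP A)) => i; rewrite coef_map.
  by case: q`_i => /= y /set_mem.
by rewrite map_poly_eq0.
Qed.

Lemma alg_closure_subfield A : subfield A -> subfield (alg_closure A).
Proof.
move=> sA; rewrite -[A]/(subfield_set (SubfieldOf sA)).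
move: (SubfieldOf sA) => {sA}A; apply/subfieldP; split.
- exact/alg_closureE/algebraic1.
- move=> x y /alg_closureE Ax /alg_closureE Ay; exact/alg_closureE/algebraic_sub.
- move=> x y /alg_closureE Ax /alg_closureE Ay; exact/alg_closureE/algebraic_div.
Qed.

Lemma alg_closure_id A : subfield A ->
  alg_closure (alg_closure A) `<=` alg_closure A.
Proof.
move=> sA x [p []]; rewrite (polyOver_coefs _ (alg_closure_subfield sA)).
move: sA => /[dup] sA; rewrite -[A]/(subfield_set (SubfieldOf sA)).
move: (SubfieldOf sA) => {sA}A _ pA p0 px.
apply/alg_closureE/integral_algebraic; apply: integral_root p0 px _.
apply/integral_poly => i; apply/integral_algebraic/alg_closureE; exact: pA.
Qed.

Section Adjoin.
Variable K : set L.

Lemma adjoin_subfield S : subfield (adjoin K S).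
Proof.
apply/subfieldP; split.
- by move=> A [sA _]; exact: sf1.
- by move=> x y xA yA A AS; apply: sfB; [have [] := AS|exact: xA|exact: yA].
- by move=> x y xA yA A AS; apply: sfdiv; [have [] := AS|exact: xA|exact: yA].
Qed.

Lemma sub_adjoin S : K `|` S `<=` adjoin K S.
Proof. by move=> x KSx A [_]; exact. Qed.

Lemma adjoin_min S A : subfield A -> K `<=` A -> S `<=` A -> adjoin K S `<=` A.
Proof. by move=> sA KA SA x; apply; split=> // y [/KA|/SA]. Qed.

End Adjoin.

End AlgebraicClosure.

Section Split.
Variables (R : realType) (L : acfield R).
Implicit Types (p : {poly L}).

Lemma poly_root p : (1 < size p)%N -> exists x, root p x.
Proof.
have pT : p \is a polyOver (mem [set: L]).
  by rewrite qualifE; apply/allP => y _; apply/mem_set.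
by move=> /(ac_closed pT)[x _ px]; exists x.
Qed.

Lemma poly_split p : exists rs, p = lead_coef p *: \prod_(r <- rs) ('X - r%:P).
Proof.
have [n] := ubnP (size p); elim: n p => // n IH p szp.
have [p1|p1] := leqP (size p) 1.
  exists [::]; rewrite big_nil alg_polyC; rewrite [in LHS](size1_polyC p1).
  by rewrite lead_coefE; case: (size p) p1 => [|[]].
have [x /factor_theorem[q pq]] := poly_root p1.
have q0 : q != 0 by apply: contraTneq p1 => q0; rewrite pq q0 mul0r size_poly0.
have [|rs qrs] := IH q.
  by move: szp; rewrite pq size_Mmonic ?monicXsubC// size_XsubC addn2.
exists (x :: rs); rewrite big_cons pq lead_coef_Mmonic ?monicXsubC//.
by rewrite [in LHS]qrs scalerAl mulrC scalerCA.
Qed.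

End Split.

(** * Complete algebraically closed subfields and the closure operator *)

Section NiceSubfields.
Variables (R : realType) (L : acfield R).
Implicit Types (A B K S : set L) (x y z : L) (e : R).
Local Notation v := (@absv R L).

(* [L] being complete and algebraically closed, these are its complete
   algebraically closed subfields. *)
Definition ac_subfield A :=
  [/\ subfield A, v_closure v A `<=` A & alg_closure A `<=` A].

Lemma v_small_eq0 x : (forall e, 0 < e -> v x < e) -> x = 0.
Proof.
move=> h; apply/eqP; rewrite -v_eq0 eq_le v_ge0 andbT leNgt.
by apply/negP => /h; rewrite ltxx.
Qed.

Lemma inv_succ_gt0 n : (0 : R) < n.+1%:R^-1.
Proof. by rewrite invr_gt0 ltr0n. Qed.

Lemma inv_succ_small e : 0 < e ->
  exists N, forall n, (N <= n)%N -> n.+1%:R^-1 < e.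
Proof.
move=> e0; exists (Num.truncn e^-1) => n Nn.
rewrite invf_plt ?posrE//; apply: lt_le_trans (truncnS_gt _) _.
by rewrite ler_nat ltnS.
Qed.

Lemma sub_v_closure A : A `<=` v_closure v A.
Proof. by move=> x Ax e e0; exists x => //; rewrite subrr v0. Qed.

Lemma v_closureS A B : A `<=` B -> v_closure v A `<=` v_closure v B.
Proof. by move=> AB x Ax e /Ax[a Aa xa]; exists a => //; exact: AB. Qed.

Lemma v_closure_id A : v_closure v (v_closure v A) `<=` v_closure v A.
Proof.
move=> x Ax e e0; have [y Ay xy] := Ax e e0; have [z Az yz] := Ay e e0.
by exists z => //; exact: vB_trans_lt xy yz.
Qed.

Lemma analytic_ac_subfield A : analytic v A -> alg_closed A -> ac_subfield A.
Proof.
move=> [sA cA] aA; split => //; last exact: alg_closure_closed.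
move=> x Ax.
have /choice[u uP] n : exists a, A a /\ v (x - a) < n.+1%:R^-1.
  by have [a Aa xa] := Ax _ (inv_succ_gt0 n); exists a.
have [||l Al ul] := cA u; first by move=> n; have [] := uP n.
  move=> e /inv_succ_small[N Ne]; exists N => m n Nm Nn.
  apply: (@vB_trans_lt _ _ _ x); last exact: lt_trans (uP n).2 (Ne _ Nn).
  by rewrite vBC; exact: lt_trans (uP m).2 (Ne _ Nm).
suff -> : x = l by [].
apply/eqP; rewrite -subr_eq0; apply/eqP/v_small_eq0 => e e0.
have [N1 N1e] := inv_succ_small e0; have [N2 N2e] := ul e e0.
apply: (@vB_trans_lt _ _ _ (u (maxn N1 N2))).
  by apply: lt_trans (uP _).2 (N1e _ _); rewrite leq_maxl.
by apply: N2e; rewrite leq_maxr.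
Qed.

Lemma ac_subfield_analytic A : ac_subfield A -> analytic v A.
Proof.
move=> [sA vA aA]; split=> // u uA uc.
have [//|l _ ul] := @ac_complete _ L u _ uc.
exists l => //; apply: vA => e e0; have [N Ne] := ul e e0.
by exists (u N) => //; rewrite vBC; exact: Ne.
Qed.

Lemma ac_subfieldT : ac_subfield [set: L].
Proof. by split=> //; exact/subfieldP. Qed.

Lemma v_closure_subfield A : subfield A -> subfield (v_closure v A).
Proof.
move=> sA; apply/subfieldP; split; first exact: (sub_v_closure (sf1 sA)).
  move=> x y Ax Ay e e0; have [a Aa xa] := Ax e e0; have [b Ab yb] := Ay e e0.
  exists (a - b); first exact: sfB.
  have -> : x - y - (a - b) = (x - a) - (y - b) by ring.
  exact: vB_lt.
move=> x y Ax Ay e e0.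
have [->|y0] := eqVneq y 0.
  by exists 0; [exact: sf0|rewrite invr0 mulr0 subrr v0].
have vy0 : 0 < v y by rewrite v_gt0.
pose M := Num.max (v x) (v y).
have M0 : 0 < M by rewrite lt_max vy0 orbT.
(* An approximation b of y within |y| satisfies |b| = |y|, so the denominator y b of x / y - a / b
   has value |y|^2; M bounds |x| and |y| in the numerator. *)
pose d := Num.min (v y) (e * v y ^+ 2 / M).
have d0 : 0 < d by rewrite lt_min vy0 divr_gt0// mulr_gt0// exprn_gt0.
have [a Aa xa] := Ax d d0; have [b Ab yb] := Ay d d0.
have vb : v b = v y.
  by rewrite -[b](subrK y) vD_dom// vBC; apply: lt_le_trans yb _; rewrite ge_min lexx.
have b0 : b != 0 by rewrite -v_eq0 vb v_eq0.
exists (a / b); first exact: sfdiv.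
have -> : x / y - a / b = ((x - a) * y - x * (y - b)) / (y * b).
  by field; rewrite ?y0 ?b0.
rewrite vM vV vM vb -expr2 ltr_pdivrMr ?exprn_gt0//.
have dM : d * M <= e * v y ^+ 2 by rewrite -ler_pdivlMr// ge_min lexx orbT.
apply: lt_le_trans dM; apply: vB_lt; rewrite vM.
  by rewrite (le_lt_trans (ler_wpM2l (v_ge0 _) (_ : _ <= M)))// ?le_max ?lexx ?orbT// ltr_pM2r.
rewrite mulrC (le_lt_trans (ler_wpM2l (v_ge0 _) (_ : _ <= M)))// ?le_max ?lexx ?orbT//.
by rewrite ltr_pM2r.
Qed.

Lemma prod_small (rs : seq L) x e :
  0 < e -> v (\prod_(r <- rs) (x - r)) < e ^+ size rs ->
  exists2 r, r \in rs & v (x - r) < e.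
Proof.
move=> e0; elim: rs => [|r rs IH]; first by rewrite big_nil v1 ltxx.
rewrite big_cons vM /= exprS => h.
have [xr|xr] := ltP (v (x - r)) e; first by exists r; rewrite ?mem_head.
have [|s srs xs] := IH; last by exists s; rewrite // inE srs orbT.
rewrite -(ltr_pM2l e0); apply: le_lt_trans h.
by rewrite ler_wpM2r// v_ge0.
Qed.

(** Approximating the coefficients of a monic equation of degree d for x gives a monic q over A with
    |q(x)| < e^d. Since |q(x)| is the product of the |x - r| over the roots r of q, some root is
    within e of x, and the roots lie in A. *)
Lemma v_closure_alg A : subfield A -> alg_closure A `<=` A ->
  alg_closure (v_closure v A) `<=` v_closure v A.
Proof.
move=> sA aA x [p [pA p0 px]] e e0.
have sV := v_closure_subfield sA.
move/(polyOver_coefs _ sV) : pA => pA.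
wlog pm : p p0 px pA / p \is monic.
  move=> /(_ ((lead_coef p)^-1 *: p)); apply.
  - by rewrite scaler_eq0 invr_eq0 lead_coef_eq0 (negPf p0).
  - by rewrite rootZ ?invr_eq0 ?lead_coef_eq0.
  - by apply: (coefs_inZ sV) => //; apply: (sfV sV); exact: pA.
  - by rewrite monicE lead_coefZ mulVf// lead_coef_eq0.
have szp := root_size_gt1 p0 px.
pose d := (size p).-1; have szd : size p = d.+1 by rewrite prednK// (ltn_trans _ szp).
pose M : R := (Num.max 1 (v x)) ^+ d.
have m1 : 1 <= Num.max 1 (v x) by rewrite le_max lexx.
have M1 : 1 <= M by rewrite exprn_ege1.
have M0 : 0 < M by rewrite (lt_le_trans ltr01).
have h0 : 0 < e ^+ d / M by rewrite divr_gt0// exprn_gt0.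
have /choice[c cP] i : exists c, A c /\ v (p`_i - c) < e ^+ d / M.
  by have [c Ac pc] := pA i _ h0; exists c.
pose q := 'X^d + \poly_(i < d) c i.
have szq : size q = d.+1.
  by rewrite size_polyDl size_polyXn// ltnS size_poly.
have qm : q \is monic.
  by rewrite monicE lead_coefE szq coefD coefXn eqxx coef_poly ltnn addr0.
have qA : coefs_in A q.
  apply: (coefs_inD sA) => i; first by rewrite coefXn; case: eqP => _; [exact: sf1|exact: sf0].
  by rewrite coef_poly; case: ifP => _; [have [] := cP i|exact: sf0].
have pd : p`_d = 1 by rewrite -(monicP pm) lead_coefE.
have qx : v q.[x] < e ^+ d.
  have -> : q.[x] = \sum_(i < d) (c i - p`_i) * x ^+ i.
    move/rootP : px; rewrite horner_coef szd big_ord_recr/= pd mul1r => /eqP.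
    rewrite addrC addr_eq0 => /eqP px.
    rewrite hornerD hornerXn px horner_poly addrC -sumrB.
    by apply: eq_bigr => i _; rewrite mulrBl.
  apply: v_sum_lt => [|i _]; first exact: exprn_gt0.
  rewrite vM vX -[e ^+ d](divfK (lt0r_neq0 M0)).
  have xM : v x ^+ i <= M.
    apply: (@le_trans _ _ (Num.max 1 (v x) ^+ i)).
      by rewrite lerXn2r ?nnegrE ?v_ge0 ?(le_trans ler01 m1)// le_max lexx orbT.
    by apply: ler_weXn2l => //; exact: ltnW.
  apply: le_lt_trans (ler_wpM2l (v_ge0 _) xM) _.
  by rewrite ltr_pM2r// vBC; have [] := cP i.
have [rs qrs] := poly_split q; move: qrs; rewrite (monicP qm) scale1r => qrs.
have szrs : size rs = d.
  by apply: succn_inj; rewrite -szq qrs size_prod_XsubC.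
have [r rrs xr] : exists2 r, r \in rs & v (x - r) < e.
  apply: prod_small => //; rewrite szrs; move: qx; rewrite qrs horner_prod.
  by under eq_bigr do rewrite hornerXsubC.
exists r => //; apply: aA; exists q; split.
- exact/(polyOver_coefs _ sA).
- by rewrite monic_neq0.
- by rewrite qrs root_prod_XsubC.
Qed.

Section Closures.
Variables (K : set L).
Local Notation cl S := (ta_closure v K S).

Lemma acl_subfield S : subfield (alg_closure (adjoin K S)).
Proof. exact/alg_closure_subfield/adjoin_subfield. Qed.

Lemma acl_alg S :
  alg_closure (alg_closure (adjoin K S)) `<=` alg_closure (adjoin K S).
Proof. exact/alg_closure_id/adjoin_subfield. Qed.

Lemma sub_acl S : K `|` S `<=` alg_closure (adjoin K S).
Proof.
move=> x /sub_adjoin; apply: sub_alg_closure; exact: adjoin_subfield.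
Qed.

Lemma acl_min S A : subfield A -> alg_closure A `<=` A ->
  K `<=` A -> S `<=` A -> alg_closure (adjoin K S) `<=` A.
Proof.
by move=> sA aA KA SA x xKS; apply: aA; apply: alg_closureS xKS; exact: adjoin_min.
Qed.

Lemma acl_sub_cl S : alg_closure (adjoin K S) `<=` cl S.
Proof. exact: sub_v_closure. Qed.

Lemma cl_ac_subfield S : ac_subfield (cl S).
Proof.
split; first exact/v_closure_subfield/acl_subfield.
  exact: v_closure_id.
by apply: v_closure_alg; [exact: acl_subfield|exact: acl_alg].
Qed.

Lemma sub_cl S : K `|` S `<=` cl S.
Proof. by move=> x /sub_acl; exact: acl_sub_cl. Qed.

Lemma base_sub_cl S : K `<=` cl S.
Proof. by move=> x Kx; apply: sub_cl; left. Qed.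

Lemma gen_sub_cl S : S `<=` cl S.
Proof. by move=> x Sx; apply: sub_cl; right. Qed.

Lemma cl_min S A : ac_subfield A -> K `<=` A -> S `<=` A -> cl S `<=` A.
Proof.
move=> [sA vA aA] KA SA x xS; apply: vA; apply: v_closureS xS.
exact: acl_min.
Qed.

Lemma cl_sub S T : S `<=` cl T -> cl S `<=` cl T.
Proof.
by move=> ST; apply: cl_min => //; [exact: cl_ac_subfield|exact: base_sub_cl].
Qed.

Lemma clS S T : S `<=` T -> cl S `<=` cl T.
Proof. by move=> ST; apply: cl_sub => x /ST; exact: gen_sub_cl. Qed.

Lemma acl_sub S T : S `<=` alg_closure (adjoin K T) ->
  alg_closure (adjoin K S) `<=` alg_closure (adjoin K T).
Proof.
move=> ST; apply: acl_min => //; first exact: acl_subfield.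
  exact: acl_alg.
by move=> x Kx; apply: sub_acl; left.
Qed.

Lemma aclS S T : S `<=` T ->
  alg_closure (adjoin K S) `<=` alg_closure (adjoin K T).
Proof. by move=> ST; apply: acl_sub => x /ST Tx; apply: sub_acl; right. Qed.

Lemma cl_acl S T : S `<=` alg_closure (adjoin K T) -> cl S `<=` cl T.
Proof. by move=> ST; apply: cl_sub => x /ST; exact: acl_sub_cl. Qed.

Lemma dist_gt0 A x : v_closure v A `<=` A -> ~ A x ->
  exists2 e, 0 < e & forall a, A a -> e <= v (x - a).
Proof.
move=> vA nAx; apply: contrapT => h; apply/nAx/vA => e e0.
apply: contrapT => h'; apply: h; exists e => // a Aa.
by rewrite leNgt; apply/negP => xa; apply: h'; exists a.
Qed.

End Closures.

End NiceSubfields.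

(** * Elements algebraic over a generated subfield *)

Section Span.
Variable L : fieldType.
Implicit Types (A B S : set L) (x y : L) (w : nat -> L) (k m : nat).

Definition lspan A w k : set L :=
  [set x | exists2 c : nat -> L, forall i, A (c i) & x = \sum_(i < k) c i * w i].

Lemma lspanS_le A w k m : subfield A -> (k <= m)%N -> lspan A w k `<=` lspan A w m.
Proof.
move=> sA km x [c cA ->]; exists (fun i => if (i < k)%N then c i else 0).
  by move=> i; case: ifP => _ //; exact: sf0.
rewrite -(subnKC km) big_split_ord /= [X in _ = _ + X]big1 ?addr0.
  by apply: eq_bigr => i _; rewrite ltn_ord.
by move=> i _; rewrite ltnNge leq_addr mul0r.
Qed.

Lemma lspanS A w k x : lspan A w k.+1 x <->
  exists y c, [/\ lspan A w k y, A c & x = y + c * w k].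
Proof.
split=> [[c cA ->]|[y [a [[c cA ->] Aa ->]]]].
  exists (\sum_(i < k) c i * w i), (c k); split => //; first by exists c.
  by rewrite big_ord_recr.
exists (fun i => if i == k then a else c i); first by move=> i; case: eqP.
rewrite big_ord_recr /= eqxx; congr (_ + _); apply: eq_bigr => i _.
by rewrite ltn_eqF.
Qed.

Section Closure.
Variables (A : set L) (w : nat -> L) (sA : subfield A).

Lemma lspan0 k : lspan A w k 0.
Proof.
exists (fun=> 0); first by move=> _; exact: sf0.
by rewrite big1// => i _; rewrite mul0r.
Qed.

Lemma lspanD k x y : lspan A w k x -> lspan A w k y -> lspan A w k (x + y).
Proof.
move=> [c cA ->] [d dA ->]; exists (fun i => c i + d i).
  by move=> i; exact: sfD.
by rewrite -big_split; apply: eq_bigr => i _; rewrite mulrDl.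
Qed.

Lemma lspanZ k a x : A a -> lspan A w k x -> lspan A w k (a * x).
Proof.
move=> Aa [c cA ->]; exists (fun i => a * c i); first by move=> i; exact: sfM.
by rewrite mulr_sumr; apply: eq_bigr => i _; rewrite mulrA.
Qed.

Lemma lspanN k x : lspan A w k x -> lspan A w k (- x).
Proof.
by rewrite -mulN1r; apply: lspanZ; apply: sfN => //; exact: sf1.
Qed.

Lemma lspanB k x y : lspan A w k x -> lspan A w k y -> lspan A w k (x - y).
Proof. by move=> kx /lspanN; exact: lspanD. Qed.

Lemma lspan_gen k i : (i < k)%N -> lspan A w k (w i).
Proof.
move=> ik; exists (fun j => if j == i then 1 else 0).
  by move=> j; case: eqP => _; [exact: sf1|exact: sf0].
rewrite (bigD1 (Ordinal ik))//= eqxx mul1r big1 ?addr0// => j ji.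
rewrite ifF ?mul0r//; apply: contraNF ji => /eqP ji.
by apply/eqP/val_inj.
Qed.

Lemma lspan_uniform n (u : nat -> L) :
  (forall i, (i < n)%N -> exists k, lspan A w k (u i)) ->
  exists k, forall i, (i < n)%N -> lspan A w k (u i).
Proof.
elim: n => [|n IH] uA; first by exists 0%N.
have [|k kP] := IH; first by move=> i /ltnW; exact: uA.
have [m mP] := uA n (leqnn _).
exists (maxn k m) => i; rewrite ltnS leq_eqVlt => /orP[/eqP->|ik].
  by apply: lspanS_le mP => //; rewrite leq_maxr.
by apply: lspanS_le (kP i ik) => //; rewrite leq_maxl.
Qed.

(** When w enumerates the monomials in elements of S, this is the ring A[S], and [wfrac] below is
    the field A(S). *)
Definition wspan : set L := [set x | exists k, lspan A w k x].

Lemma wspanD x y : wspan x -> wspan y -> wspan (x + y).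
Proof.
move=> [k kx] [m my]; exists (maxn k m); apply: lspanD.
  by apply: lspanS_le kx => //; rewrite leq_maxl.
by apply: lspanS_le my => //; rewrite leq_maxr.
Qed.

Lemma wspanZ a x : A a -> wspan x -> wspan (a * x).
Proof. by move=> Aa [k kx]; exists k; exact: lspanZ. Qed.

Lemma wspanB x y : wspan x -> wspan y -> wspan (x - y).
Proof. by move=> wx [k ky]; apply: wspanD => //; exists k; exact: lspanN. Qed.

Lemma wspan_gen i : wspan (w i).
Proof. by exists i.+1; exact: lspan_gen. Qed.

Lemma wspan_sum (I : Type) (s : seq I) (f : I -> L) :
  (forall i, wspan (f i)) -> wspan (\sum_(i <- s) f i).
Proof.
by move=> fP; apply: (big_ind wspan) => //; [exists 0%N; exact: lspan0|exact: wspanD].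
Qed.

Hypothesis w_mul : forall i j, exists m, w i * w j = w m.

Lemma wspanM x y : wspan x -> wspan y -> wspan (x * y).
Proof.
move=> [k [c cA ->]] [m [d dA ->]]; rewrite mulr_suml; apply: wspan_sum => i.
rewrite mulr_sumr; apply: wspan_sum => j; rewrite mulrACA.
have [l ->] := w_mul i j; apply: wspanZ; first exact: sfM.
exact: wspan_gen.
Qed.

Hypothesis w_one : exists i, w i = 1.

Lemma wspan1 : wspan 1.
Proof. by have [i <-] := w_one; exact: wspan_gen. Qed.

Lemma wspan_base x : A x -> wspan x.
Proof. by move=> Ax; rewrite -(mulr1 x); apply: wspanZ => //; exact: wspan1. Qed.

Definition wfrac : set L := [set x | exists a b, [/\ wspan a, wspan b, b != 0 & x = a / b]].

Lemma wfrac_subfield : subfield wfrac.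
Proof.
apply/subfieldP; split.
- by exists 1, 1; rewrite divr1 oner_eq0; split => //; exact: wspan1.
- move=> _ _ [a [b [wa wb b0 ->]]] [c [d [wc wd d0 ->]]].
  exists (a * d - c * b), (b * d); split; rewrite ?mulf_neq0//.
  + by apply: wspanB; exact: wspanM.
  + exact: wspanM.
  + by field; rewrite ?b0 ?d0.
- move=> _ _ [a [b [wa wb b0 ->]]] [c [d [wc wd d0 ->]]].
  have [->|c0] := eqVneq c 0.
    exists 0, 1; rewrite mul0r invr0 mulr0 oner_eq0 mul0r; split => //.
      by exists 0%N; exact: lspan0.
    exact: wspan1.
  exists (a * d), (b * c); split; rewrite ?mulf_neq0//; try exact: wspanM.
  by field; rewrite ?b0 ?c0 ?d0.
Qed.

Variable S : set L.
Hypothesis w_gen : forall x, S x -> exists i, w i = x.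

Lemma adjoin_wfrac : adjoin A S `<=` wfrac.
Proof.
move=> x; apply; split; first exact: wfrac_subfield.
move=> y [Ay|/w_gen[i <-]].
  exists y, 1; rewrite divr1 oner_eq0; split => //; [exact: wspan_base|exact: wspan1].
exists (w i), 1; rewrite divr1 oner_eq0; split => //; [exact: wspan_gen|exact: wspan1].
Qed.

Lemma common_denominator (u : nat -> L) n : (forall i, wfrac (u i)) ->
  exists d, [/\ wspan d, d != 0 & forall i, (i < n)%N -> wspan (d * u i)].
Proof.
move=> uP; elim: n => [|n [d [wd d0 dP]]].
  by exists 1; split; [exact: wspan1|exact: oner_neq0|].
have [a [b [wa wb b0 uab]]] := uP n.
exists (d * b); split; [exact: wspanM|exact: mulf_neq0|] => i.
rewrite ltnS leq_eqVlt => /orP[/eqP->|/dP ?].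
  by rewrite uab -mulrA [b * _]mulrC divfK//; exact: wspanM.
by rewrite mulrAC; exact: wspanM.
Qed.

(** Clear denominators in an equation for b over A(S) and group the terms by the w_i. The dependence
    on the generators becomes polynomial and explicit, so that the generators can later be moved
    while the G_i stay fixed. *)
Lemma alg_adjoin_rep b : alg_closure (adjoin A S) b ->
  exists k (G : nat -> {poly L}), [/\ forall i, coefs_in A (G i),
    \sum_(i < k) w i *: G i != 0 & root (\sum_(i < k) w i *: G i) b].
Proof.
move=> [p [pA p0 pb]].
have sAS := adjoin_subfield A S.
move/(polyOver_coefs _ sAS) : pA => pA.
have [d [_ d0 dP]] := common_denominator (size p) (fun i => adjoin_wfrac (pA i)).
have [k kP] := lspan_uniform dP.
have /choice[c cP] j : exists c : nat -> L, (j < size p)%N ->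
    (forall i, A (c i)) /\ d * p`_j = \sum_(i < k) c i * w i.
  have [jp|jp] := ltnP j (size p); last by exists (fun=> 0).
  by have [c cA cE] := kP j jp; exists c.
pose G i := \poly_(j < size p) c j i.
have GE : \sum_(i < k) w i *: G i = d *: p.
  apply/polyP => j; rewrite coef_sum coefZ.
  have [jp|jp] := ltnP j (size p); last first.
    rewrite nth_default// mulr0 big1// => i _.
    by rewrite coefZ coef_poly ltnNge jp mulr0.
  rewrite (cP j jp).2; apply: eq_bigr => i _.
  by rewrite coefZ coef_poly jp mulrC.
exists k, G; rewrite GE; split.
- move=> i j; rewrite coef_poly; case: ifP => [jp|_]; last exact: sf0.
  by have [] := cP j jp.
- by rewrite scaler_eq0 (negPf d0).
- by rewrite rootZ.
Qed.

End Closure.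

Lemma alg_adjoin1_rep A x b : subfield A -> alg_closure (adjoin A [set x]) b ->
  exists k (G : nat -> {poly L}), [/\ forall i, coefs_in A (G i),
    \sum_(i < k) x ^+ i *: G i != 0 & root (\sum_(i < k) x ^+ i *: G i) b].
Proof.
move=> sA; apply: (alg_adjoin_rep (w := fun i => x ^+ i)) => //.
- by move=> i j; exists (i + j)%N; rewrite exprD.
- by exists 0%N.
- by move=> y ->; exists 1%N.
Qed.

End Span.

Section Exchange.
Variables (R : realType) (L : acfield R).
Implicit Types (A K S : set L) (x y z : L).

Lemma adjoin_adjoin K S T : adjoin (adjoin K S) T = adjoin K (S `|` T).
Proof.
apply/seteqP; split.
  apply: adjoin_min; first exact: adjoin_subfield.
    apply: adjoin_min; first exact: adjoin_subfield.
      by move=> x Kx; apply: sub_adjoin; left.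
    by move=> x Sx; apply: sub_adjoin; right; left.
  by move=> x Tx; apply: sub_adjoin; right; right.
apply: adjoin_min; first exact: adjoin_subfield.
  by move=> x Kx; apply: sub_adjoin; left; apply: sub_adjoin; left.
move=> x [Sx|Tx]; last by apply: sub_adjoin; right.
by apply: sub_adjoin; left; apply: sub_adjoin; right.
Qed.

(** Read the relation between x and z as an equation for x with coefficients G_i(z). It is not
    identically zero, as z would otherwise be a root of a nonzero G_i over A. *)
Lemma alg_exchange A x z : subfield A ->
  alg_closure (adjoin A [set x]) z -> ~ alg_closure A z ->
  alg_closure (adjoin A [set z]) x.
Proof.
move=> sA /(alg_adjoin1_rep sA)[k [G [GA P0 Pz]]] nz.
have sz := adjoin_subfield A [set z].
have Gz i : adjoin A [set z] (G i).[z].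
  apply: (sf_horner sz); last by apply: sub_adjoin; right.
  by move=> j; apply: sub_adjoin; left; exact: GA.
exists (\poly_(i < k) (G i).[z]); split.
- apply/(polyOver_coefs _ sz) => i; rewrite coef_poly; case: ifP => _ //.
  exact: sf0.
- apply: contra_notN nz => /eqP/polyP Q0.
  have [i Gi0] : exists i : 'I_k, G i != 0.
    apply/existsP; apply: contraNT P0; rewrite negb_exists => /forallP G0.
    by rewrite big1// => i _; move: (G0 i); rewrite negbK => /eqP->; rewrite scaler0.
  exists (G i); split => //; first exact/(polyOver_coefs _ sA).
  by have := Q0 i; rewrite coef_poly ltn_ord coef0 => /eqP.
- move: Pz; rewrite /root horner_sum horner_poly => /eqP; rewrite -[X in _ == X]/0 => Pz.
  apply/eqP; rewrite -[RHS]Pz; apply: eq_bigr => i _.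
  by rewrite hornerZ mulrC.
Qed.

Lemma acl_exchange K S x z :
  alg_closure (adjoin K (S `|` [set x])) z -> ~ alg_closure (adjoin K S) z ->
  alg_closure (adjoin K (S `|` [set z])) x.
Proof.
rewrite -!adjoin_adjoin; apply: alg_exchange; exact: adjoin_subfield.
Qed.

End Exchange.

(** * Perturbation of independent sets *)

Section Roots.
Variables (R : realType) (L : acfield R).
Implicit Types (A K S T : set L) (x y z : L) (P : {poly L}) (r : R).
Local Notation v := (@absv R L).

(* The absolute values of the coefficients of a polynomial decide whether it has
   a root of absolute value at most [r]. *)
Lemma root_small_coef P t r : P != 0 -> root P t -> v t <= r ->
  exists j, [/\ (0 < j)%N, P`_j != 0 & v P`_0 <= v P`_j * r ^+ j].
Proof.
move=> P0 /rootP Pt tr; apply: contrapT => h.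
have r0 : 0 <= r by apply: le_trans tr; exact: v_ge0.
have small j : (0 < j)%N -> v (P`_j * t ^+ j) <= v P`_j * r ^+ j.
  move=> _; rewrite vM vX ler_wpM2l ?v_ge0//.
  by rewrite lerXn2r ?nnegrE ?v_ge0.
have hj j : (0 < j)%N -> P`_j != 0 -> v P`_j * r ^+ j < v P`_0.
  by move=> j0 Pj; rewrite ltNge; apply/negP => hle; apply: h; exists j.
have [P00|P00] := eqVneq P`_0 0.
  have [j j0 Pj] : exists2 j, (0 < j)%N & P`_j != 0.
    exists (size P).-1; last by rewrite -lead_coefE lead_coef_eq0.
    rewrite lt0n; apply: contraNneq P0 => s0.
    by rewrite -lead_coef_eq0 lead_coefE s0 P00.
  have := hj j j0 Pj; rewrite P00 v0 ltNge => /negP; apply.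
  by rewrite mulr_ge0 ?v_ge0 ?exprn_ge0.
have P0gt : 0 < v P`_0 by rewrite v_gt0.
have : v (\sum_(i < (size P).-1) P`_i.+1 * t ^+ i.+1) < v P`_0.
  apply: v_sum_lt => // i _; apply: le_lt_trans (small _ _) _ => //.
  have [->|Pi] := eqVneq P`_i.+1 0; first by rewrite v0 mul0r.
  exact: hj.
rewrite horner_coef (polySpred P0) big_ord_recl expr0 mulr1 in Pt.
move/eqP : Pt; rewrite addrC addr_eq0 => /eqP.
by move=> ->; rewrite vN ltxx.
Qed.

(** Induction on the roots: a new factor X - t with |t| > r multiplies the constant coefficient by
    |t|, while the other terms, weighted by powers of r, grow by at most |t|. *)
Lemma prod_XsubC_coef_lt (rs : seq L) r j : 0 <= r ->
  (forall t, t \in rs -> r < v t) -> (0 < j)%N ->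
  v (\prod_(t <- rs) ('X - t%:P))`_j * r ^+ j < v (\prod_(t <- rs) ('X - t%:P))`_0.
Proof.
move=> r0; elim: rs j => [|t rs IH] j rs_gt.
  by case: j => // j _; rewrite big_nil !coef1 v0 mul0r v1.
have rs_gt' u : u \in rs -> r < v u by move=> us; apply: rs_gt; rewrite inE us orbT.
have {}IH i := IH i rs_gt'.
have tr : r < v t by apply: rs_gt; rewrite mem_head.
rewrite big_cons; move: (\prod_(_ <- _) _) IH => q IH.
case: j => // j _.
rewrite !mulrBl !coefB !coefXM !coefCM /= sub0r vN vM.
have q0 : 0 < v q`_0.
  apply: le_lt_trans (IH 1%N isT); rewrite mulr_ge0 ?v_ge0 ?exprn_ge0//.
have t0 : 0 < v t by apply: le_lt_trans tr.
have h1 : v q`_j * r ^+ j.+1 < v t * v q`_0.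
  rewrite exprSr mulrA [v t * _]mulrC.
  apply: (@le_lt_trans _ _ (v q`_0 * r)); last by rewrite ltr_pM2l.
  rewrite ler_wpM2r//; case: j => [|j]; first by rewrite expr0 mulr1.
  exact/ltW/IH.
have h2 : v t * v q`_j.+1 * r ^+ j.+1 < v t * v q`_0.
  by rewrite -mulrA ltr_pM2l//; exact: IH.
have rj : 0 <= r ^+ j.+1 by rewrite exprn_ge0.
apply: (@le_lt_trans _ _ (Num.max (v q`_j * r ^+ j.+1) (v t * v q`_j.+1 * r ^+ j.+1))).
  rewrite -maxr_pMl//; apply: ler_wpM2r => //.
  by have := vD_max q`_j (- (t * q`_j.+1)); rewrite vN vM.
by rewrite gt_max h1.
Qed.

Lemma coef_small_root P r j : 0 <= r -> (0 < j)%N -> P`_j != 0 ->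
  v P`_0 <= v P`_j * r ^+ j -> exists2 t, root P t & v t <= r.
Proof.
move=> r0 j0 Pj h; apply: contrapT => nr.
have [rs Prs] := poly_split P.
have lP : lead_coef P != 0.
  by rewrite lead_coef_eq0; apply: contraNneq Pj => ->; rewrite coef0.
have rs_gt t : t \in rs -> r < v t.
  move=> trs; rewrite ltNge; apply/negP => tr; apply: nr; exists t => //.
  by rewrite Prs rootZ// root_prod_XsubC.
move: h; rewrite leNgt => /negP; apply.
rewrite Prs !coefZ !vM -mulrA ltr_pM2l ?v_gt0//.
exact: prod_XsubC_coef_lt.
Qed.

(** The polynomial f splits over N, and each factor X - t with t in N has the same absolute value at
    y and at z. *)
Lemma horner_eq_dist (N : set L) y z f : ac_subfield N ->
  (forall c, N c -> v (y - c) = v (z - c)) -> coefs_in N f ->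
  v f.[y] = v f.[z].
Proof.
move=> [sN _ aN] yz fN.
have [->|f0] := eqVneq f 0; first by rewrite !horner0.
have [rs frs] := poly_split f.
have rsN t : t \in rs -> N t.
  move=> trs; apply: aN; exists f; split => //; first exact/(polyOver_coefs _ sN).
  by rewrite frs rootZ ?lead_coef_eq0// root_prod_XsubC.
rewrite frs !hornerZ !vM; congr (_ * _).
elim: rs rsN {frs} => [|t rs IH] rsN; first by rewrite big_nil !hornerC.
rewrite big_cons !hornerM !vM !hornerXsubC yz; last by apply: rsN; rewrite mem_head.
by rewrite IH// => u us; apply: rsN; rewrite inE us orbT.
Qed.

(* For G over [A], the coefficients of G(y, c + T) and G(z, c + T) have the same
   absolute values, so their smallest roots are equally small. *)
Lemma alg_transfer (N A : set L) y z p c : ac_subfield N -> subfield A -> A `<=` N ->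
  (forall a, N a -> v (y - a) = v (z - a)) ->
  alg_closure (adjoin A [set z]) p -> N c ->
  exists2 p', alg_closure (adjoin A [set y]) p' & v (p' - c) <= v (p - c).
Proof.
move=> nN sA AN yz /(alg_adjoin1_rep sA)[k [G [GA P0 Pp]]] Nc.
have sN : subfield N by have [] := nN.
pose P (u : L) := (\sum_(i < k) u ^+ i *: G i).
(* The value of f j at u is the coefficient of T^j in G(u, c + T); as f j is over N, its absolute
   values at y and z agree. *)
pose f j := \poly_(i < k) (G i \Po ('X + c%:P))`_j.
have fN j : coefs_in N (f j).
  move=> i; rewrite coef_poly; case: ifP => _; last exact: sf0.
  apply: (coefs_in_comp sN) => [l|]; first exact/AN/GA.
  by apply: (coefs_inD sN); [exact: (coefs_inX sN)|exact: (coefs_inC sN)].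
have PfE u j : (P u \Po ('X + c%:P))`_j = (f j).[u].
  rewrite /P linear_sum coef_sum horner_poly; apply: eq_bigr => i _.
  by rewrite linearZ coefZ mulrC.
have fyz j : v (f j).[y] = v (f j).[z] by exact: horner_eq_dist yz (fN j).
have Q0 : P z \Po ('X + c%:P) != 0.
  by rewrite comp_poly2_eq0// size_XaddC.
have [j [j0 Qj Qle]] : exists j, [/\ (0 < j)%N, (P z \Po ('X + c%:P))`_j != 0 &
    v (P z \Po ('X + c%:P))`_0 <= v (P z \Po ('X + c%:P))`_j * v (p - c) ^+ j].
  apply: (root_small_coef (t := p - c)) => //.
  by rewrite /root horner_comp hornerD hornerX hornerC subrK.
rewrite !PfE -!fyz -v_eq0 -fyz in Qj Qle.
have [||t Pt tc] := @coef_small_root (P y \Po ('X + c%:P)) (v (p - c)) j (v_ge0 _) j0.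
- by rewrite PfE -v_eq0.
- by rewrite !PfE.
exists (c + t); last by rewrite addrC addKr.
exists (P y); split.
- apply/(polyOver_coefs _ (adjoin_subfield _ _)).
  apply: (coefs_in_sum (adjoin_subfield _ _)) => i _.
  apply: (coefs_inZ (adjoin_subfield _ _)).
    by apply: (sfX (adjoin_subfield _ _)); apply: sub_adjoin; right.
  by move=> l; apply: sub_adjoin; left; exact: GA.
- apply: contraNneq Qj => Py0; rewrite -PfE Py0 comp_poly0 coef0 v0 //.
- by move: Pt; rewrite /root horner_comp hornerD hornerX hornerC addrC.
Qed.

End Roots.

Section Independence.
Variables (R : realType) (L : acfield R) (K : set L).
Implicit Types (S T : set L) (x y z : L).
Local Notation v := (@absv R L).
Local Notation cl S := (ta_closure v K S).

(** The field cl (T, w) contains w itself, so [alg_transfer] with centre w replaces each element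
    near w and algebraic over K(T, z) by one at least as near and algebraic over K(T, y). *)
Lemma cl_transfer T w y z :
  (forall c, cl (T `|` [set w]) c -> v (y - c) = v (z - c)) ->
  cl (T `|` [set z]) w -> cl (T `|` [set y]) w.
Proof.
move=> yz wz e e0; have [p pz wp] := wz e e0; rewrite -adjoin_adjoin in pz.
have sub : adjoin K T `<=` cl (T `|` [set w]).
  apply: adjoin_min; first by have [] := cl_ac_subfield K (T `|` [set w]).
    exact: base_sub_cl.
  by move=> x Tx; apply: gen_sub_cl; left.
have ww : cl (T `|` [set w]) w by apply: gen_sub_cl; right.
have [p' p'y p'w] := alg_transfer (cl_ac_subfield K _) (adjoin_subfield _ _) sub yz pz ww.
exists p'; first by rewrite -adjoin_adjoin.
by apply: le_lt_trans wp; rewrite vBC [leRHS]vBC.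
Qed.

Definition cl_indep S := forall x, S x -> ~ cl (S `\ x) x.

(** A proper subset of S omits some x and so lies in S \ x; hence it is enough to test these
    subsets. *)
Lemma cl_indepP S : ta_independent v K S <-> cl_indep S.
Proof.
split=> [iS x Sx xS|iS T [ST TS]].
  have SxS : S `\ x `<` S by split=> [y []//|/(_ x Sx)[_]]; apply.
  have [_] := iS (S `\ x) SxS; apply.
  apply: cl_sub => y Sy.
  by have [->//|yx] := eqVneq y x; apply: gen_sub_cl; split => //; exact/eqP.
split; first exact: clS.
have [x [Sx nTx]] : exists x, S x /\ ~ T x.
  by apply: contrapT => h; apply: TS => x Sx; apply: contrapT => nTx; apply: h; exists x.
move=> /(_ x (gen_sub_cl K Sx)) xT; apply: (iS x Sx); apply: clS xT => y Ty.
by split; [exact: ST|move=> /= yx; apply: nTx; rewrite -yx].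
Qed.

Lemma cl_indep_sub S T : T `<=` S -> cl_indep S -> cl_indep T.
Proof.
move=> TS iS x Tx xT; apply: (iS x (TS x Tx)); apply: clS xT.
by move=> y [/TS Sy yx].
Qed.

(** Take for e a positive lower bound of the distances from y to cl T: a z closer than e to y has
    the same distances to cl T. A dependence of some w in T on z and the rest of T would then
    transfer from z to y. *)
Lemma cl_indep_perturb T y : ~ T y -> cl_indep (T `|` [set y]) ->
  exists2 e, 0 < e & forall z, v (y - z) < e ->
    [/\ ~ T z, cl_indep (T `|` [set z]) &
        forall c, cl T c -> v (y - c) = v (z - c)].
Proof.
move=> nTy iTy.
have sub : T `<=` (T `|` [set y]) `\ y.
  by move=> x Tx; split; [left|move=> /= xy; apply: nTy; rewrite -xy].
have ny : ~ cl T y.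
  by move=> yT; apply: (iTy y); [right|apply: clS yT].
have [sT vT aT] := cl_ac_subfield K T.
have [e e0 ye] := dist_gt0 vT ny.
exists e => // z yz.
have dyz c : cl T c -> v (y - c) = v (z - c).
  by move=> Tc; rewrite (@v_close _ _ z y c)// vBC; apply: lt_le_trans (ye c Tc).
have nz : ~ cl T z.
  move=> Tz; have := dyz z Tz; rewrite subrr v0 => /eqP.
  by rewrite v_eq0 subr_eq0 => /eqP yzE; apply: ny; rewrite yzE.
have nTz : ~ T z by move=> /(gen_sub_cl K).
split => // w [Tw|->]; last first.
  by move=> h; apply: nz; apply: clS h => x [[]].
move=> h; apply: (iTy w); first by left.
have wy : y != w by apply: contra_notN nTy => /eqP->.
suff : cl ((T `\ w) `|` [set y]) w.
  apply: clS => x [[Tx xw]|->]; split=> //=; [by left|by right|exact/eqP].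
apply: (@cl_transfer _ _ _ z).
  move=> c hc; apply: dyz; apply: cl_sub hc => x [[Tx _]|->]; exact: gen_sub_cl.
apply: clS h => x [[Tx|->] xw]; last by right.
by left.
Qed.

End Independence.

(** * Extension of isometries *)

Section ClosedSpan.
Variables (R : realType) (L : acfield R).
Implicit Types (x y : L) (w : nat -> L).
Local Notation v := (@absv R L).
Variable B : set L.
Hypotheses (sB : subfield B) (vB : v_closure v B `<=` B).

Lemma span_dist_scale w k t d y c :
  (forall u, lspan B w k u -> d <= v (t - u)) ->
  lspan B w k y -> B c -> d * v c <= v (y + c * t).
Proof.
move=> dt ky Bc; have [->|c0] := eqVneq c 0.
  by rewrite v0 mulr0 v_ge0.
have -> : y + c * t = c * (t - (- c^-1 * y)) by field.
rewrite vM mulrC ler_wpM2l ?v_ge0//; apply: dt; apply: lspanZ => //.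
by apply: (sfN sB); exact: sfV.
Qed.

(** Induction on k. If w_k is not in the span of the earlier vectors, which is closed, it has a
    positive distance to it; by [span_dist_scale] the coefficients of w_k in a convergent sequence
    are then Cauchy, and they converge in B. *)
Lemma lspan_closed w k : v_closure v (lspan B w k) `<=` lspan B w k.
Proof.
elim: k => [|k IH] x xk.
  suff -> : x = 0 by exact: lspan0.
  apply: v_small_eq0 => e /xk[_ [c _ ->]].
  by rewrite big_ord0 subr0.
have [wk|wk] := pselect (lspan B w k (w k)).
  apply: (@lspanS_le _ _ _ k) => //; apply: IH => e /xk[y yk xy].
  exists y => //; have /lspanS[z [c [kz Bc ->]]] := yk.
  by apply: lspanD => //; exact: lspanZ.
have [d d0 dk] := dist_gt0 IH wk.
have /choice[u uP] n : exists yc : L * L,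
    [/\ lspan B w k yc.1, B yc.2 & v (x - (yc.1 + yc.2 * w k)) < n.+1%:R^-1].
  by have [_ /lspanS[y [c [ky Bc ->]]] h] := xk _ (inv_succ_gt0 R n); exists (y, c).
have [||c _ cl] := @ac_complete _ L (fun n => (u n).2) => //.
  move=> e e0; have [N Ne] := inv_succ_small (mulr_gt0 d0 e0).
  exists N => m n Nm Nn; have [km Bm xm] := uP m; have [kn Bn xn] := uP n.
  rewrite -(ltr_pM2l d0); apply: le_lt_trans (span_dist_scale dk (lspanB sB km kn) (sfB sB Bm Bn)) _.
  set a := v _; have -> : a = v ((x - ((u n).1 + (u n).2 * w k)) - (x - ((u m).1 + (u m).2 * w k))).
    by rewrite /a; congr v; ring.
  by apply: vB_lt; [apply: lt_trans xn _|apply: lt_trans xm _]; exact: Ne.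
have Bc : B c.
  apply: vB => e /cl[N Ne]; exists (u N).2; first by have [] := uP N.
  by rewrite vBC; exact: Ne.
apply/lspanS; exists (x - c * w k), c; split => //; last by rewrite subrK.
apply: IH => e e0.
have wk0 : 0 < v (w k).
  by rewrite v_gt0; apply: contra_notN wk => /eqP->; exact: lspan0.
have [N1 N1e] := inv_succ_small e0.
have [N2 N2e] := cl _ (divr_gt0 e0 wk0).
pose N := maxn N1 N2; have [kN BN xN] := uP N.
exists (u N).1 => //.
have -> : x - c * w k - (u N).1 = (x - ((u N).1 + (u N).2 * w k)) + ((u N).2 - c) * w k by ring.
apply: vD_lt; first by apply: lt_trans xN _; apply: N1e; rewrite leq_maxl.
by rewrite vM -ltr_pdivlMr//; apply: N2e; rewrite leq_maxr.
Qed.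

End ClosedSpan.

Section IsometricRings.
Variables (R : realType) (L : acfield R).
Implicit Types (x y z : L) (G H : set (L * L)).
Local Notation v := (@absv R L).

(* The graphs of the isometric ring homomorphisms between subrings of [L]. *)
Definition isometric_ring G :=
  [/\ G 1, forall p q, G p -> G q -> G (p - q),
      forall p q, G p -> G q -> G (p * q) &
      forall p, G p -> v p.1 = v p.2].

Definition dom G : set L := [set x | exists y, G (x, y)].
Definition transpose G : set (L * L) := [set p | G (p.2, p.1)].

Lemma transpose_isometric G : isometric_ring G -> isometric_ring (transpose G).
Proof.
move=> [G1 GB GM Gv]; split => //.
- by move=> p q Gp Gq; exact: GB Gp Gq.
- by move=> p q Gp Gq; exact: GM Gp Gq.
- by move=> p /Gv.
Qed.

Section Ops.
Variables (G : set (L * L)) (iG : isometric_ring G).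

Lemma ir1 : G 1. Proof. by have [] := iG. Qed.
Lemma irB p q : G p -> G q -> G (p - q). Proof. by have [_ h _ _] := iG; exact: h. Qed.
Lemma irM p q : G p -> G q -> G (p * q). Proof. by have [_ _ h _] := iG; exact: h. Qed.
Lemma irv p : G p -> v p.1 = v p.2. Proof. by have [_ _ _ h] := iG; exact: h. Qed.
Lemma ir0 : G 0. Proof. by rewrite -(subrr 1); exact: irB ir1 ir1. Qed.
Lemma irN p : G p -> G (- p).
Proof. by move=> Gp; rewrite -(sub0r p); exact: irB ir0 Gp. Qed.
Lemma irD p q : G p -> G q -> G (p + q).
Proof. by move=> Gp Gq; rewrite -(opprK q); apply: irB => //; exact: irN. Qed.
Lemma irX p n : G p -> G (p ^+ n).
Proof.
by move=> Gp; elim: n => [|n IH]; rewrite ?expr0 ?exprS; [exact: ir1|exact: irM].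
Qed.
Lemma ir_sum (I : Type) (s : seq I) (f : I -> L * L) :
  (forall i, G (f i)) -> G (\sum_(i <- s) f i).
Proof. by move=> fG; apply: (big_ind G) => //; [exact: ir0|exact: irD]. Qed.
Lemma ir_eq0 p : G p -> (p.1 == 0) = (p.2 == 0).
Proof. by move=> /irv pv; rewrite -!(v_eq0 (L := L)) pv. Qed.
Lemma ir_fun x y z : G (x, y) -> G (x, z) -> y = z.
Proof.
move=> Gy Gz; apply/eqP; rewrite -subr_eq0.
by have /= <- := ir_eq0 (irB Gy Gz); rewrite subrr.
Qed.

End Ops.

Definition maximal_ring G := isometric_ring G /\
  forall H, isometric_ring H -> G `<=` H -> H `<=` G.

Lemma maximal_ring_exists G : isometric_ring G ->
  exists2 H, maximal_ring H & G `<=` H.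
Proof.
move=> iG.
(* Adding [G] makes the property hold for the union of the empty chain. *)
have [F FP Ftot|H [iH Hmax]] := @Zorn_bigcup _ (fun H => isometric_ring (G `|` H)).
  have pick2 p q : (G `|` \bigcup_(X in F) X) p -> (G `|` \bigcup_(X in F) X) q ->
      exists H, [/\ isometric_ring H, H `<=` G `|` \bigcup_(X in F) X, H p & H q].
    have sub X : F X -> G `|` X `<=` G `|` \bigcup_(X in F) X.
      by move=> FX r [Gr|Xr]; [left|right; exists X].
    move=> [Gp|[X FX Xp]] [Gq|[Y FY Yq]].
    - by exists G; split => // r; left.
    - by exists (G `|` Y); split; [exact: FP|exact: sub|left|right].
    - by exists (G `|` X); split; [exact: FP|exact: sub|right|left].
    - have [XY|YX] := Ftot X Y FX FY.
        by exists (G `|` Y); split; [exact: FP|exact: sub|right; exact: XY|right].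
      by exists (G `|` X); split; [exact: FP|exact: sub|right|right; exact: YX].
  split.
  - by left; exact: ir1.
  - by move=> p q /pick2 h /h[H [iH HG Hp Hq]]; apply: HG; exact: irB.
  - by move=> p q /pick2 h /h[H [iH HG Hp Hq]]; apply: HG; exact: irM.
  - by move=> p Gp; have [H [iH HG Hp _]] := pick2 p p Gp Gp; exact: (irv iH Hp).
exists (G `|` H); last by move=> p; left.
split => // H' iH' GH' p Hp; apply: contrapT => np.
apply: (Hmax H').
  split=> [q Hq|/(_ p Hp) ?]; first by apply: GH'; right.
  by apply: np; right.
by rewrite (_ : G `|` H' = H')//; apply/setUidPr => q Gq; apply: GH'; left.
Qed.

Lemma maximal_transpose G : maximal_ring G -> maximal_ring (transpose G).
Proof.
move=> [iG mG]; split; first exact: transpose_isometric.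
move=> H iH GH [x y] Hxy.
apply: (mG (transpose H)); first exact: transpose_isometric.
  by move=> [a b] Gab; apply: (GH (b, a)).
exact: Hxy.
Qed.

Section Maximal.
Variables (G : set (L * L)) (mG : maximal_ring G).
Let iG : isometric_ring G := proj1 mG.
Let maxG := proj2 mG.

(** The fractions formed from G are again an isometric ring containing G, hence lie in G by
    maximality. *)
Lemma maximal_div p q : G p -> G q -> G (p.1 / q.1, p.2 / q.2).
Proof.
move=> Gp Gq; have [q0|q0] := eqVneq q.1 0.
  have /eqP q20 : q.2 == 0 by rewrite -(ir_eq0 iG Gq) q0.
  by rewrite q0 q20 !invr0 !mulr0; exact: ir0 iG.
pose H : set (L * L) := [set r | exists a s, [/\ G a, G s, s.1 != 0 &
  r = (a.1 / s.1, a.2 / s.2)]].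
apply: (maxG (H := H)); last by exists p, q.
  split.
  - by exists 1, 1; rewrite /= !divr1 oner_neq0; split => //; exact: ir1.
  - move=> _ _ [a [s [Ga Gs s0 ->]]] [b [t [Gb Gt t0 ->]]].
    have s20 : s.2 != 0 by rewrite -(ir_eq0 iG Gs).
    have t20 : t.2 != 0 by rewrite -(ir_eq0 iG Gt).
    exists (a * t - b * s), (s * t); split.
    + by apply: (irB iG); exact: irM.
    + exact: irM.
    + exact: mulf_neq0.
    + by congr (_, _) => /=; field; rewrite ?s0 ?t0 ?s20 ?t20.
  - move=> _ _ [a [s [Ga Gs s0 ->]]] [b [t [Gb Gt t0 ->]]].
    exists (a * b), (s * t); split; try exact: irM; first exact: mulf_neq0.
    by congr (_, _); rewrite mulf_div.
  - move=> _ [a [s [Ga Gs s0 ->]]].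
    by rewrite !vM !vV (irv iG Ga) (irv iG Gs).
move=> r Gr; exists r, 1; rewrite /= !divr1 oner_neq0; split => //; first exact: ir1.
by case: r Gr.
Qed.

Lemma dom_subfield : subfield (dom G).
Proof.
apply/subfieldP; split.
- by exists 1; exact: ir1.
- by move=> x y [x' Gx] [y' Gy]; exists (x' - y'); exact: (irB iG Gx Gy).
- by move=> x y [x' Gx] [y' Gy]; exists (x' / y'); exact: maximal_div Gx Gy.
Qed.

(** The closure of G in L x L is again an isometric ring, so maximality applies. *)
Lemma maximal_closed x y :
  (forall e, 0 < e -> exists2 p, G p & v (x - p.1) < e /\ v (y - p.2) < e) ->
  G (x, y).
Proof.
pose H : set (L * L) := [set r |
  forall e, 0 < e -> exists2 p, G p & v (r.1 - p.1) < e /\ v (r.2 - p.2) < e].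
move=> Hxy; apply: (maxG (H := H)) => //; last first.
  by move=> r Gr e e0; exists r; rewrite // !subrr v0.
split.
- by move=> e e0; exists 1; [exact: ir1|rewrite !subrr v0].
- move=> r s Hr Hs e e0; have [p Gp [p1 p2]] := Hr e e0; have [q Gq [q1 q2]] := Hs e e0.
  exists (p - q); first exact: irB.
  split.
    have -> : (r - s).1 - (p - q).1 = (r.1 - p.1) - (s.1 - q.1) by rewrite /=; ring.
    exact: vB_lt.
  have -> : (r - s).2 - (p - q).2 = (r.2 - p.2) - (s.2 - q.2) by rewrite /=; ring.
  exact: vB_lt.
- move=> r s Hr Hs e e0.
  pose M := Num.max 1 (Num.max (Num.max (v r.1) (v r.2)) (Num.max (v s.1) (v s.2))).
  have M1 : 1 <= M by rewrite le_max lexx.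
  have M0 : 0 < M by exact: lt_le_trans M1.
  have [s1M s2M] : v s.1 <= M /\ v s.2 <= M by rewrite !le_max !lexx !orbT.
  have [r1M r2M] : v r.1 <= M /\ v r.2 <= M by rewrite !le_max !lexx !orbT.
  pose d := Num.min 1 (e / M).
  have d0 : 0 < d by rewrite lt_min ltr01 divr_gt0.
  have dM : d * M <= e by rewrite -ler_pdivlMr// ge_min lexx orbT.
  have d1 : d <= M by apply: le_trans M1; rewrite ge_min lexx.
  have [p Gp [p1 p2]] := Hr d d0; have [q Gq [q1 q2]] := Hs d d0.
  exists (p * q); first exact: irM.
  have key (a b c f : L) : v a <= M -> v b <= M -> v (a - c) < d -> v (b - f) < d ->
      v (a * b - c * f) < e.
    move=> aM bM ac bf; have -> : a * b - c * f = (a - c) * b + c * (b - f) by ring.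
    have cM : v c <= M.
      by rewrite -[c](subKr a); apply: vB_le => //; apply: le_trans d1; exact: ltW.
    apply: lt_le_trans dM; apply: vD_lt; rewrite vM.
      by apply: (@le_lt_trans _ _ (v (a - c) * M)); rewrite ?ltr_pM2r// ler_wpM2l ?v_ge0.
    by apply: (@le_lt_trans _ _ (M * v (b - f))); rewrite ?ler_wpM2r ?v_ge0// mulrC ltr_pM2r.
  by split; apply: key.
- move=> r Hr.
  have key (a b : L) : (forall e, 0 < e ->
      exists c f, [/\ v c = v f, v (a - c) < e & v (b - f) < e]) -> v a <= v b.
    move=> h; rewrite leNgt; apply/negP => ba.
    have a0 : 0 < v a by apply: le_lt_trans ba; exact: v_ge0.
    have [c [f [cf ac bf]]] := h _ a0.
    have : v f < v a by rewrite -[f](subKr b) vB_lt.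
    by rewrite -cf -[c](subKr a) vB_dom// ltxx.
  apply/eqP; rewrite eq_le; apply/andP; split; apply: key => e /Hr[p Gp [p1 p2]].
    by exists p.1, p.2; split => //; exact: (irv iG Gp).
  by exists p.2, p.1; split => //; rewrite (irv iG Gp).
Qed.

(** An isometry sends a Cauchy sequence to a Cauchy sequence, whose limit exists in L; the pair of
    limits lies in G by [maximal_closed]. *)
Lemma dom_closed : v_closure v (dom G) `<=` dom G.
Proof.
move=> x xG.
have /choice[u uP] n : exists p, G p /\ v (x - p.1) < n.+1%:R^-1.
  by have [a [b Gab] xa] := xG _ (inv_succ_gt0 R n); exists (a, b).
have [||y _ uy] := @ac_complete _ L (fun n => (u n).2) => //.
  move=> e /inv_succ_small[N Ne]; exists N => m n Nm Nn.
  have /= <- := irv iG (irB iG (uP m).1 (uP n).1).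
  apply: (@vB_trans_lt _ _ _ x); last exact: lt_trans (uP n).2 (Ne _ Nn).
  by rewrite vBC; exact: lt_trans (uP m).2 (Ne _ Nm).
exists y; apply: maximal_closed => e e0.
have [N1 N1e] := inv_succ_small e0; have [N2 N2e] := uy _ e0.
exists (u (maxn N1 N2)); first by have [] := uP (maxn N1 N2).
split; first by apply: lt_trans (uP _).2 (N1e _ _); rewrite leq_maxl.
by rewrite vBC; apply: N2e; rewrite leq_maxr.
Qed.

End Maximal.

End IsometricRings.

(** If x > y > 0, the powers of x / y grow at least linearly by Bernoulli's inequality and exceed
    C. *)
Lemma le_of_power_bound (R : realType) (x y C : R) : 0 <= y ->
  (forall n, x ^+ n <= C * y ^+ n) -> x <= y.
Proof.
move=> y0 h; rewrite leNgt; apply/negP => yx.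
have [yE|y_gt0] := eqVneq y 0.
  by have := h 1%N; rewrite !expr1 {1}yE mulr0 => /(lt_le_trans yx); rewrite yE ltxx.
have {}y_gt0 : 0 < y by rewrite lt0r y_gt0.
pose t := x / y; have t1 : 0 < t - 1 by rewrite subr_gt0 ltr_pdivlMr// mul1r.
have tC n : t ^+ n <= C by rewrite expr_div_n ler_pdivrMr ?exprn_gt0.
have bern n : 1 + n%:R * (t - 1) <= t ^+ n.
  elim: n => [|n IH]; first by rewrite mul0r addr0 expr0.
  rewrite exprS; apply: (@le_trans _ _ (t * (1 + n%:R * (t - 1)))); last first.
    by rewrite ler_wpM2l// -subr_ge0; lra.
  have n0 : 0 <= n%:R * (t - 1) ^+ 2 :> R by rewrite mulr_ge0 ?ler0n ?exprn_ge0 ?ltW.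
  by rewrite -natr1; nra.
have := truncnS_gt (C / (t - 1)); rewrite ltr_pdivrMr// => hC.
by have := le_trans (bern _) (tC (Num.truncn (C / (t - 1))).+1); lra.
Qed.

Section AlgebraicRelations.
Variables (L : fieldType) (B : set L).
Hypothesis sB : subfield B.
Implicit Types (x : L) (p : {poly L}).

(** Here d is the degree of x over B. Minimality is phrased with spans so that it yields positive
    distances through [lspan_closed]. *)
Lemma alg_min_relation x : alg_closure B x -> exists d,
  lspan B (fun i => x ^+ i) d (x ^+ d) /\
  forall k, (k < d)%N -> ~ lspan B (fun i => x ^+ i) k (x ^+ k).
Proof.
move=> [p [/(polyOver_coefs _ sB) pB p0 /rootP px]].
pose P k := `[< lspan B (fun i => x ^+ i) k (x ^+ k) >].
have exP : exists k, P k.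
  exists (size p).-1; apply/asboolP.
  exists (fun i => - (p`_i / lead_coef p)).
    by move=> i; apply: (sfN sB); apply: (sfdiv sB); exact: pB.
  move: px; rewrite horner_coef (polySpred p0) big_ord_recr /= -lead_coefE => px.
  have l0 : lead_coef p != 0 by rewrite lead_coef_eq0.
  apply: (mulfI l0); move/eqP: px; rewrite addrC addr_eq0 => /eqP->.
  rewrite mulr_sumr -sumrN; apply: eq_bigr => i _.
  by rewrite mulNr mulrN mulrA [lead_coef p * _]mulrC divfK.
exists (ex_minn exP); case: ex_minnP => d /asboolP Pd dmin; split => // k kd.
by move=> /asboolP/dmin; rewrite leqNgt kd.
Qed.

(** Divide an equation for x by the highest possible power of X, so that its constant term is
    nonzero, and solve for that term. *)
Lemma alg_inverse x : alg_closure B x -> x != 0 -> exists n (c : nat -> L),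
  (forall i, B (c i)) /\ x * (\sum_(i < n) c i * x ^+ i) = 1.
Proof.
move=> [p [/(polyOver_coefs _ sB) pB p0 px]] x0.
have exi : exists i, p`_i != 0 by exists (size p).-1; rewrite -lead_coefE lead_coef_eq0.
have [i0 pi0 imin] := ex_minnP exi.
have take0 : take_poly i0 p = 0.
  apply/polyP => i; rewrite coef_take_poly coef0; case: ifP => // ii0.
  by apply/eqP; apply: contraTT ii0 => /imin; rewrite -leqNgt.
pose q := drop_poly i0 p.
have pE : p = q * 'X^i0 by rewrite -[LHS](poly_take_drop i0) take0 add0r.
have q0 : q`_0 != 0 by rewrite coef_drop_poly add0n.
have qB i : B q`_i by rewrite coef_drop_poly; exact: pB.
have /rootP qx : root q x.
  move: px; rewrite pE rootM => /orP[//|]; rewrite /root hornerXn expf_eq0.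
  by rewrite (negPf x0) andbF.
exists (size q).-1, (fun i => - (q`_i.+1 / q`_0)); split.
  by move=> i; apply: (sfN sB); apply: (sfdiv sB).
have qn0 : q != 0 by apply: contraNneq q0 => ->; rewrite coef0.
move: qx; rewrite horner_coef (polySpred qn0) big_ord_recl expr0 mulr1 => /eqP.
rewrite addr_eq0 => /eqP qx; apply: (mulfI q0); rewrite mulr1 [RHS]qx.
rewrite mulr_sumr mulr_sumr -sumrN; apply: eq_bigr => i _.
by rewrite mulNr !mulrN /= exprS /bump /=; field.
Qed.

End AlgebraicRelations.

(* Adjoining to [G] a pair of corresponding roots [(b, b')]; as [dom G] is
   complete, [W d] is finite free over it, whence a bound on the new homomorphism. *)
Section FiniteExtension.
Variables (R : realType) (L : acfield R).
Implicit Types (x y z : L) (G H : set (L * L)).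
Local Notation v := (@absv R L).

Variables (G : set (L * L)) (mG : maximal_ring G).
Let iG : isometric_ring G := proj1 mG.
Let B := dom G.
Let sB : subfield B := dom_subfield mG.
Let vB : v_closure v B `<=` B := @dom_closed _ _ _ mG.

Variables (b b' : L) (d : nat) (g0 : nat -> L * L).
Let T : L * L := (b, b').
Hypothesis Gg0 : forall i, G (g0 i).
Hypothesis Td : T ^+ d = \sum_(i < d) g0 i * T ^+ i.
Hypothesis d_min :
  forall k, (k < d)%N -> ~ lspan B (fun i => b ^+ i) k (b ^+ k).

(** Pairs are multiplied componentwise, so W d is the subring G[T] of L x L: the graph of the
    intended extension, sending b to b'. *)
Let W k : set (L * L) :=
  [set p | exists2 g : nat -> L * L, forall i, G (g i) & p = \sum_(i < k) g i * T ^+ i].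

Let W0 k : W k 0.
Proof. by exists (fun=> 0); [move=> _; exact: ir0|rewrite big1// => i _; rewrite mul0r]. Qed.

Let WD k p q : W k p -> W k q -> W k (p + q).
Proof.
move=> [g gG ->] [h hG ->]; exists (fun i => g i + h i).
  by move=> i; exact: irD.
by rewrite -big_split; apply: eq_bigr => i _; rewrite mulrDl.
Qed.

Let WZ k a p : G a -> W k p -> W k (a * p).
Proof.
move=> Ga [g gG ->]; exists (fun i => a * g i); first by move=> i; exact: irM.
by rewrite mulr_sumr; apply: eq_bigr => i _; rewrite mulrA.
Qed.

Let WB k p q : W k p -> W k q -> W k (p - q).
Proof.
move=> Wp Wq; apply: WD => //; rewrite -mulN1r; apply: WZ => //.
by apply: irN => //; exact: ir1.
Qed.

Let W_sum k (I : Type) (s : seq I) (f : I -> L * L) :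
  (forall i, W k (f i)) -> W k (\sum_(i <- s) f i).
Proof. by move=> fW; apply: (big_ind (W k)) => //; exact: WD. Qed.

Let W_gen k i : (i < k)%N -> W k (T ^+ i).
Proof.
move=> ik; exists (fun j => if j == i then 1 else 0).
  by move=> j; case: eqP => _; [exact: ir1|exact: ir0].
rewrite (bigD1 (Ordinal ik))//= eqxx mul1r big1 ?addr0// => j ji.
rewrite ifF ?mul0r//; apply: contraNF ji => /eqP ji.
by apply/eqP/val_inj.
Qed.

Let WS k p : W k.+1 p -> exists q c, [/\ W k q, G c & p = q + c * T ^+ k].
Proof.
move=> [g gG ->]; exists (\sum_(i < k) g i * T ^+ i), (g k).
by split; [exists g| |rewrite big_ord_recr].
Qed.

Let W_mulT p : W d p -> W d (T * p).
Proof.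
move=> [g gG ->]; rewrite mulr_sumr; apply: W_sum => i.
rewrite mulrCA -exprS; apply: WZ => //.
have [id|id] := ltnP i.+1 d; first exact: W_gen.
have -> : i.+1 = d by apply/eqP; rewrite eqn_leq id ltn_ord.
by exists g0.
Qed.

Let WM p q : W d p -> W d q -> W d (p * q).
Proof.
move=> [g gG ->] Wq; rewrite mulr_suml; apply: W_sum => i.
rewrite -mulrA; apply: WZ => //; elim: {i}(i : nat) => [|i IH].
  by rewrite expr0 mul1r.
by rewrite exprS -mulrA; exact: W_mulT.
Qed.

Let W_base a : G a -> W d a.
Proof.
move=> Ga; rewrite -(mulr1 a); apply: WZ => //; rewrite -(expr0 T).
have [d0|d0] := posnP d; last exact: W_gen.
by rewrite -d0 Td; exists g0.
Qed.

Let W_fst k p : W k p -> lspan B (fun i => b ^+ i) k p.1.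
Proof.
move=> [g gG ->]; exists (fun i => (g i).1).
  by move=> i; exists (g i).2; rewrite -surjective_pairing.
by rewrite (big_morph fst (id1 := 0) (op1 := +%R))//; apply: eq_bigr => i _; rewrite rmorphM rmorphXn.
Qed.

(** Induction on k. As b^k has positive distance e to the closed span of the lower powers, the top
    coefficient c of p satisfies |c.1| <= |p.1| / e; subtracting c.1 b^k then bounds the lower part
    as well. *)
Let W_bound k : (k <= d)%N ->
  exists2 C, 0 <= C & forall p, W k p -> v p.2 <= C * v p.1.
Proof.
elim: k => [|k IH] kd.
  by exists 0 => // _ [g _ ->]; rewrite big_ord0 v0 mul0r.
have [C C0 Cb] := IH (ltnW kd).
have [e e0 eb] := dist_gt0 (@lspan_closed _ _ _ sB vB _ k) (d_min kd).
exists (Num.max (C * (Num.max 1 (v b ^+ k / e))) (v b' ^+ k / e)).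
  by rewrite le_max mulr_ge0// le_max ler01.
move=> _ /WS[q [c [Wq Gc ->]]].
have -> : (q + c * T ^+ k).1 = q.1 + c.1 * b ^+ k by rewrite rmorphD rmorphM rmorphXn.
have -> : (q + c * T ^+ k).2 = q.2 + c.2 * b' ^+ k by rewrite rmorphD rmorphM rmorphXn.
have Bc : B c.1 by exists c.2; rewrite -surjective_pairing.
have h : v c.1 <= v (q.1 + c.1 * b ^+ k) / e.
  by rewrite ler_pdivlMr// mulrC; apply: (span_dist_scale sB eb) => //; exact: W_fst.
set x := q.1 + _ in h *.
have qx : v q.1 <= Num.max 1 (v b ^+ k / e) * v x.
  have -> : q.1 = x - c.1 * b ^+ k by rewrite /x addrK.
  apply: vB_le; rewrite ?vM ?vX.
    by rewrite ler_peMl ?v_ge0// le_max lexx.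
  apply: (@le_trans _ _ (v b ^+ k / e * v x)).
    by rewrite mulrC -mulrA ler_wpM2l ?exprn_ge0 ?v_ge0// mulrC.
  by rewrite ler_wpM2r ?v_ge0// le_max lexx orbT.
rewrite maxr_pMl ?v_ge0//.
apply: le_trans (vD_max _ _) _; rewrite ge_max !le_max.
apply/andP; split; apply/orP; [left|right].
  by apply: le_trans (Cb _ Wq) _; rewrite -mulrA ler_wpM2l.
rewrite vM vX -(irv iG Gc) mulrC -mulrA ler_wpM2l ?exprn_ge0 ?v_ge0//.
by rewrite mulrC.
Qed.

(* A multiplicative map with [v p.2 <= C * v p.1] is contracting: apply the bound
   to the powers of [p]. *)
Let W_power p : W d p -> v p.2 <= v p.1.
Proof.
move=> Wp; have [C C0 Cb] := W_bound (leqnn d).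
have Wpn n : W d (p ^+ n).
  elim: n => [|n IH]; first by rewrite expr0; apply: W_base; exact: ir1.
  by rewrite exprS; exact: WM.
apply: (@le_of_power_bound _ _ _ C); rewrite ?v_ge0// => n.
by have := Cb _ (Wpn n); rewrite !rmorphXn /= !vX.
Qed.

(** The inverse of p.1 is a polynomial in p.1, hence the first component of some q in W d. The
    contraction applied to p q - 1 shows that q.2 is the inverse of p.2, and applied to q it gives
    the reverse inequality. *)
Let W_isometric p : alg_closure B b -> W d p -> v p.1 = v p.2.
Proof.
move=> Bb Wp; apply/eqP; rewrite eq_le W_power// andbT.
have [->|p0] := eqVneq p.1 0; first by rewrite v0 v_ge0.
have Bp : alg_closure B p.1.
  have [c cB ->] := W_fst Wp.
  have sa := alg_closure_subfield sB.
  apply: (sf_sum sa) => i _; apply: (sfM sa); first exact: sub_alg_closure.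
  exact: sfX.
have [n [c [cB pc]]] := alg_inverse sB Bp p0.
have /choice[c' c'G] i : exists y, G (c i, y) by have [y] := cB i; exists y.
pose q : L * L := \sum_(i < n) (c i, c' i) * p ^+ i.
have Wq : W d q.
  apply: W_sum => i; apply: WZ => //; elim: {i}(i : nat) => [|i IH].
    by rewrite expr0; apply: W_base; exact: ir1.
  by rewrite exprS; exact: WM.
have q1 : q.1 = \sum_(i < n) c i * p.1 ^+ i.
  rewrite (big_morph fst (id1 := 0) (op1 := +%R))//.
  by apply: eq_bigr => i _; rewrite rmorphM rmorphXn.
have pq1 : (p * q - 1).1 = 0 by rewrite rmorphB rmorphM /= q1 pc subrr.
have /eqP : v (p * q - 1).2 == 0.
  rewrite eq_le v_ge0 andbT -[X in _ <= X](v0 L) -pq1; apply: W_power.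
  by apply: WB; [exact: WM|apply: W_base; exact: ir1].
move/eqP; rewrite v_eq0 rmorphB rmorphM /= subr_eq0 => /eqP pq2.
have q20 : 0 < v q.2.
  by rewrite v_gt0; apply: contra_eq_neq pq2 => ->; rewrite mulr0 eq_sym oner_neq0.
have vpq1 : v p.1 * v q.1 = 1 by rewrite -vM q1 pc v1.
have vpq2 : v p.2 * v q.2 = 1 by rewrite -vM pq2 v1.
rewrite -(ler_pM2r q20) vpq2 -vpq1; apply: ler_wpM2l; rewrite ?v_ge0//.
exact: W_power.
Qed.

(** By the preceding facts W d is an isometric ring containing G, so it is contained in G by
    maximality; and it contains T. *)
Lemma finite_extension_mem : alg_closure B b -> (0 < d)%N -> B b.
Proof.
move=> Bb d0; exists b'.
have iW : isometric_ring (W d).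
  split; [|exact: WB|exact: WM|by move=> p; exact: W_isometric].
  by apply: W_base; exact: ir1.
apply: (proj2 mG _ iW); first by move=> p; exact: W_base.
rewrite -[X in W d X](mulr1 T); apply: W_mulT; apply: W_base; exact: ir1.
Qed.

End FiniteExtension.

Section MaximalDomain.
Variables (R : realType) (L : acfield R).
Local Notation v := (@absv R L).

Lemma dom_alg (G : set (L * L)) : maximal_ring G -> alg_closure (dom G) `<=` dom G.
Proof.
move=> mG b Gb; have iG := proj1 mG.
have [d [[c cG bd] dmin]] := alg_min_relation (dom_subfield mG) Gb.
have d0 : (0 < d)%N.
  rewrite lt0n; apply/eqP => d0; move: bd; rewrite d0 expr0 big_ord0 => /eqP.
  by rewrite oner_eq0.
have /choice[c' c'G] i : exists y, G (c i, y) by have [y] := cG i; exists y.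
(* This is the minimal equation of b with its coefficients carried over by G; any root can serve as
   the image b'. *)
pose P : {poly L} := 'X^d - \poly_(i < d) c' i.
have szP : size P = d.+1.
  by rewrite size_polyDl size_polyXn// size_polyN ltnS size_poly.
have [|b' Pb'] := @poly_root _ L P; first by rewrite szP.
have b'd : b' ^+ d = \sum_(i < d) c' i * b' ^+ i.
  move: Pb'; rewrite /root hornerD hornerN hornerXn horner_poly subr_eq0.
  by move/eqP.
apply: (finite_extension_mem mG (b' := b') (d := d) (g0 := fun i => (c i, c' i))) => //.
rewrite [LHS]surjective_pairing [RHS]surjective_pairing; congr (_, _).
  rewrite (big_morph fst (id1 := 0) (op1 := +%R))// rmorphXn /= bd.
  by apply: eq_bigr => i _; rewrite rmorphXn.
rewrite (big_morph snd (id1 := 0) (op1 := +%R))// rmorphXn /= b'd.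
by apply: eq_bigr => i _; rewrite rmorphXn.
Qed.

(* The graphs of the isometric isomorphisms between complete algebraically
   closed subfields. *)
Definition ac_isometry (G : set (L * L)) :=
  [/\ isometric_ring G, ac_subfield (dom G) & ac_subfield (dom (transpose G))].

Lemma ac_isometry_transpose G : ac_isometry G -> ac_isometry (transpose G).
Proof.
by move=> [iG dG cG]; split => //; exact: transpose_isometric.
Qed.

(** The transpose of a maximal graph is maximal, so the closure properties of the domain hold for
    the range too. *)
Lemma ac_isometry_extend G : isometric_ring G -> exists2 H, ac_isometry H & G `<=` H.
Proof.
move=> /maximal_ring_exists[H mH GH]; exists H => //.
have mH' := maximal_transpose mH.
split; first by have [] := mH.
  by split; [exact: dom_subfield|exact: dom_closed|exact: dom_alg].
by split; [exact: dom_subfield|exact: dom_closed|exact: dom_alg].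
Qed.

Section Preimage.
Variables (G : set (L * L)) (aG : ac_isometry G) (C : set L).
Hypotheses (aC : ac_subfield C).

Let iG : isometric_ring G. Proof. by have [] := aG. Qed.

Lemma ac_isometry_div x y x' y' : G (x, x') -> G (y, y') -> G (x / y, x' / y').
Proof.
move=> Gx Gy; have [y0|y0] := eqVneq y 0.
  have /eqP y'0 : y' == 0 by have /= <- := ir_eq0 iG Gy; rewrite y0.
  by rewrite y0 y'0 !invr0 !mulr0; exact: ir0 iG.
have y'0 : y' != 0 by have /= <- := ir_eq0 iG Gy.
have [z Gz] : dom G (x / y).
  have [_ [sG _ _] _] := aG.
  by apply: (sfdiv sG); [exists x'|exists y'].
have := irM iG Gz Gy.
rewrite (_ : (_, _) * _ = (x, z * y')); last by congr (_, _); rewrite /= divfK.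
by move=> /(ir_fun iG Gx) ->; rewrite mulfK.
Qed.

Lemma ac_isometry_horner (p : {poly L}) (c : nat -> L) n x x' :
  (forall i, G (p`_i, c i)) -> G (x, x') -> (size p <= n)%N ->
  G (p.[x], \sum_(i < n) c i * x' ^+ i).
Proof.
move=> Gp Gx pn; rewrite (horner_coef_wide _ pn).
have : G (\sum_(i < n) (p`_i, c i) * (x, x') ^+ i).
  by apply: (ir_sum iG) => i; apply: (irM iG) => //; exact: irX.
rewrite [X in G X]surjective_pairing.
rewrite (big_morph fst (id1 := 0) (op1 := +%R))// (big_morph snd (id1 := 0) (op1 := +%R))//.
by under eq_bigr do rewrite rmorphM rmorphXn; under [X in (_, X)]eq_bigr do rewrite rmorphM rmorphXn.
Qed.

(** Together with [cl_min], this shows that G maps cl S into cl S' once it does so on generators. *)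
Lemma ac_isometry_preimage : ac_subfield [set x | exists2 y, C y & G (x, y)].
Proof.
have [sC vC algC] := aC; have [_ [sG vG algG] _] := aG.
have sub : [set x | exists2 y, C y & G (x, y)] `<=` dom G by move=> x [y _ Gxy]; exists y.
have sA : subfield [set x | exists2 y, C y & G (x, y)].
  apply/subfieldP; split.
  - by exists 1; [exact: sf1|exact: ir1 iG].
  - move=> x y [x' Cx Gx] [y' Cy Gy]; exists (x' - y'); first exact: sfB.
    exact: (irB iG Gx Gy).
  - move=> x y [x' Cx Gx] [y' Cy Gy]; exists (x' / y'); first exact: sfdiv.
    exact: ac_isometry_div.
split => //.
- move=> x xA; have [z Gz] := vG _ (v_closureS sub xA).
  exists z => //; apply: vC => e /xA[a [a' Ca' Ga] xa]; exists a' => //.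
  by have /= <- := irv iG (irB iG Gz Ga).
- move=> x xA; have [z Gz] := algG _ (alg_closureS sub xA).
  exists z => //; have [p [pA p0 /rootP px]] := xA; apply: algC.
  move/(polyOver_coefs _ sA) : pA => pA.
  have /choice[c cP] i : exists y, C y /\ G (p`_i, y).
    by have [y Cy Gy] := pA i; exists y.
  have c0 i : (p`_i == 0) = (c i == 0) by have /= -> := ir_eq0 iG (cP i).2.
  exists (\poly_(i < size p) c i); split.
  + apply/(polyOver_coefs _ sC) => i; rewrite coef_poly; case: ifP => _; last exact: sf0.
    by have [] := cP i.
  + apply: contraNneq p0 => /polyP h; rewrite -size_poly_eq0 -leqn0 leqNgt.
    apply/negP => sp; have := h (size p).-1; rewrite coef_poly prednK// leqnn coef0.
    by move/eqP; rewrite -c0 -lead_coefE lead_coef_eq0 -size_poly_eq0 -leqn0 leqNgt sp.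
  + have := ac_isometry_horner (fun i => (cP i).2) Gz (leqnn _).
    rewrite px => /(ir_eq0 iG) /= h; rewrite /root horner_poly -h eqxx //.
Qed.

End Preimage.

Lemma ac_isometry_cl (K S S' : set L) G x y : ac_isometry G ->
  (forall k, K k -> G (k, k)) -> (forall s, S s -> exists2 s', S' s' & G (s, s')) ->
  G (x, y) -> ta_closure v K S x -> ta_closure v K S' y.
Proof.
move=> aG GK GS Gxy.
have aA := ac_isometry_preimage aG (cl_ac_subfield K S').
move=> /(cl_min aA); case.
- by move=> k Kk; exists k; [exact: base_sub_cl|exact: GK].
- by move=> s /GS[s' S's Gss]; exists s' => //; exact: gen_sub_cl.
- by move=> z Cz; have [iG _ _] := aG => /(ir_fun iG Gxy) ->.
Qed.

End MaximalDomain.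

(** * Exchange *)

Section SteinitzExchange.
Variables (R : realType) (L : acfield R) (K : set L).
Implicit Types (x y z : L) (S T Z : set L) (xs ys zs : seq L).
Local Notation v := (@absv R L).
Local Notation cl S := (ta_closure v K S).
Local Notation acl S := (alg_closure (adjoin K S)).

Definition isometric_over S T := exists G : set (L * L),
  [/\ isometric_ring G, dom G = S, dom (transpose G) = T & forall k, K k -> G (k, k)].

Lemma isometric_over_refl S : subfield S -> K `<=` S -> isometric_over S S.
Proof.
move=> sS KS; exists [set p | S p.1 /\ p.1 = p.2]; split.
- split=> [|p q [Sp pE] [Sq qE]|p q [Sp pE] [Sq qE]|p [_ ->//]].
  + by split=> //; exact: sf1.
  + by split; [exact: sfB|rewrite /= pE qE].
  + by split; [exact: sfM|rewrite /= pE qE].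
- by apply/seteqP; split=> [x [y []//]|x Sx]; exists x.
- by apply/seteqP; split=> [x [y [/= Sy <-]]//|x Sx]; exists x.
- by move=> k /KS.
Qed.

Lemma isometric_over_trans S T Z :
  isometric_over S T -> isometric_over T Z -> isometric_over S Z.
Proof.
move=> [G [iG GS GT GK]] [H [iH HT HZ HK]].
exists [set p | exists2 y, G (p.1, y) & H (y, p.2)]; split.
- split.
  + by exists 1; exact: ir1.
  + move=> p q [y Gy Hy] [z Gz Hz]; exists (y - z).
      exact: (irB iG Gy Gz).
    exact: (irB iH Hy Hz).
  + move=> p q [y Gy Hy] [z Gz Hz]; exists (y * z).
      exact: (irM iG Gy Gz).
    exact: (irM iH Hy Hz).
  + by move=> p [y /(irv iG) /= -> /(irv iH)].
- apply/seteqP; split=> [x [z [y Gxy _]]|x]; first by rewrite -GS; exists y.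
  rewrite -GS => -[y Gxy]; have : T y by rewrite -GT; exists x.
  by rewrite -HT => -[z Hyz]; exists z, y.
- apply/seteqP; split=> [z [x [y _ Hyz]]|z]; first by rewrite -HZ; exists y.
  rewrite -HZ => -[y Hyz]; have : T y by rewrite -HT; exists z.
  by rewrite -GT => -[x Gxy]; exists x, y.
- by move=> k Kk; exists k; [exact: GK|exact: HK].
Qed.

(** By [horner_eq_dist], f(z) -> f(y) is an isometry between the rings generated over cl T. Extend
    it to complete algebraically closed fields, then restrict to cl (T, z), whose image is cl (T,
    y). *)
Lemma isometric_over_close T y z : (forall c, cl T c -> v (y - c) = v (z - c)) ->
  isometric_over (cl (T `|` [set z])) (cl (T `|` [set y])).
Proof.
move=> yz; have aT := cl_ac_subfield K T; have [sT _ _] := aT.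
pose G0 : set (L * L) := [set p | exists2 f, coefs_in (cl T) f & p = (f.[z], f.[y])].
have iG0 : isometric_ring G0.
  split.
  - by exists 1; [exact: (coefs_inC sT (sf1 sT))|rewrite !hornerC].
  - move=> _ _ [f fT ->] [g gT ->]; exists (f - g); first exact: coefs_inB.
    by rewrite !hornerD !hornerN.
  - move=> _ _ [f fT ->] [g gT ->]; exists (f * g); first exact: coefs_inM.
    by rewrite !hornerM.
  - by move=> _ [f fT ->] /=; apply/esym; exact: horner_eq_dist yz fT.
have [H aH G0H] := ac_isometry_extend iG0; have [iH dH cH] := aH.
have HT c : cl T c -> H (c, c).
  by move=> Tc; apply: G0H; exists c%:P; [exact: (coefs_inC sT)|rewrite !hornerC].
have HK c : K c -> H (c, c) by move=> Kc; apply: HT; exact: base_sub_cl.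
have Hzy : H (z, y).
  by apply: G0H; exists 'X; [exact: (coefs_inX sT)|rewrite !hornerX].
have to_y p : H p -> cl (T `|` [set z]) p.1 -> cl (T `|` [set y]) p.2.
  case: p => a b Hab; apply: (ac_isometry_cl aH HK _ Hab) => s [Ts|->].
    by exists s; [left|apply: HT; exact: gen_sub_cl].
  by exists y; [right|].
have to_z p : H p -> cl (T `|` [set y]) p.2 -> cl (T `|` [set z]) p.1.
  case: p => a b Hab.
  apply: (ac_isometry_cl (ac_isometry_transpose aH) _ _ (Hab : transpose H (b, a))) => //.
  move=> s [Ts|->]; last by exists z; [right|].
  by exists s; [left|apply: HT; exact: gen_sub_cl].
have dHz : cl (T `|` [set z]) `<=` dom H.
  apply: cl_min => // [c Kc|c [Tc|->]]; first by exists c; exact: HK.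
    by exists c; apply: HT; exact: gen_sub_cl.
  by exists y.
have cHy : cl (T `|` [set y]) `<=` dom (transpose H).
  apply: cl_min => // [c Kc|c [Tc|->]]; first by exists c; exact: HK.
    by exists c; apply: HT; exact: gen_sub_cl.
  by exists z.
have [sz _ _] := cl_ac_subfield K (T `|` [set z]).
exists [set p | H p /\ cl (T `|` [set z]) p.1]; split.
- split.
  + by split; [exact: (ir1 iH)|exact: (sf1 sz)].
  + by move=> p q [Hp Tp] [Hq Tq]; split; [exact: (irB iH)|exact: (sfB sz)].
  + by move=> p q [Hp Tp] [Hq Tq]; split; [exact: (irM iH)|exact: (sfM sz)].
  + by move=> p [Hp _]; exact: (irv iH Hp).
- apply/seteqP; split=> [a [b []//]|a Ta].
  by have [b Hab] := dHz a Ta; exists b.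
- apply/seteqP; split=> [b [a [Hab Ta]]|b Tb]; first exact: to_y Hab Ta.
  by have [a Hab] := cHy b Tb; exists a; split => //; exact: to_z Hab Tb.
- by move=> k Kk; split; [exact: HK|exact: base_sub_cl].
Qed.

Lemma first_prefix (P : seq L -> Prop) xs : ~ P [::] -> P xs ->
  exists xs1 x xs2, [/\ xs = xs1 ++ x :: xs2, ~ P xs1 & P (rcons xs1 x)].
Proof.
elim/last_ind: xs => // xs x IH P0 Px.
have [Pxs|nP] := pselect (P xs); last by exists xs, x, [::]; rewrite cats1.
have [xs1 [y [xs2 [-> nP1 P1]]]] := IH P0 Pxs.
by exists xs1, y, (rcons xs2 x); rewrite -rcons_cons -rcons_cat.
Qed.

(* Steinitz exchange, except that the first of the [ys] is first moved by less than
   [e] into the algebraic closure of K(Z, xs), where algebraic exchange applies. *)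
Lemma exchange_perturb ys Z xs e : 0 < e -> uniq ys ->
  (forall y, y \in ys -> ~ Z y) -> cl_indep K (Z `|` [set` ys]) ->
  (forall y, y \in ys -> cl (Z `|` [set` xs]) y) ->
  (size ys <= size xs)%N /\ (size ys = size xs -> exists ys',
    [/\ size ys' = size ys /\
        (forall i, (i < size ys)%N -> v (ys`_i - ys'`_i) < e),
        [set` ys'] `<=` acl (Z `|` [set` xs]),
        [set` xs] `<=` acl (Z `|` [set` ys']) &
        isometric_over (cl (Z `|` [set` ys'])) (cl (Z `|` [set` ys]))]).
Proof.
move=> e0; elim: ys Z xs => [|y ys IH] Z xs uy nZ iZ yxs.
  split=> // /esym/size0nil ->; exists [::]; split => //.
  by apply: isometric_over_refl; [have [] := cl_ac_subfield K (Z `|` [set` [::]])|exact: base_sub_cl].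
move: uy => /= /andP[yys uys].
have Ecat u : Z `|` [set` u :: ys] = (Z `|` [set` ys]) `|` [set u].
  rewrite -setUA; congr (_ `|` _); apply/seteqP; split=> x /=; rewrite inE.
    by case/orP => [/eqP|]; [right|left].
  by move=> [->|->]; rewrite ?eqxx ?orbT.
have nTy : ~ (Z `|` [set` ys]) y.
  by move=> [/nZ|/= h]; [apply; rewrite mem_head|rewrite h in yys].
rewrite Ecat in iZ *.
have [d d0 dP] := cl_indep_perturb nTy iZ.
have yx : cl (Z `|` [set` xs]) y by apply: yxs; rewrite mem_head.
(* Replace y by an algebraic approximation z, within e as demanded and within d so that independence
   survives. *)
have [|z zx yz] := yx (Num.min e d); first by rewrite lt_min e0.
move: yz; rewrite lt_min => /andP[yze /dP[nTz iTz dyz]].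
have nz : ~ acl Z z.
  move=> /acl_sub_cl Zz; apply: (iTz z); first by right.
  by apply: clS Zz => x Zx; split=> /=; [left; left|move=> xz; apply: nTz; left; rewrite -xz].
have nz' : ~ acl (Z `|` [set` [::]]) z.
  by rewrite (_ : [set` [::]] = set0) ?setU0//; apply/seteqP; split.
(* The first x whose addition makes z algebraic can be traded for z. *)
have [xs1 [x [xs2 [xsE nxs1 zxs1]]]] := first_prefix (P := fun s => acl (Z `|` [set` s]) z) nz' zx.
have xz : acl ((Z `|` [set` xs1]) `|` [set z]) x.
  apply: acl_exchange nxs1; apply: aclS zxs1 => u [Zu|/=]; first by left; left.
  by rewrite mem_rcons inE => /orP[/eqP->|h]; [right|left; right].
(* The element z joins the base and x leaves the generators; [sub1] and [sub2] show that the
   algebraic closure is unchanged, so induction applies to the remaining ys. *)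
pose Z' := Z `|` [set z]; pose xs' := xs1 ++ xs2.
have sub1 : acl (Z `|` [set` xs]) `<=` acl (Z' `|` [set` xs']).
  apply: acl_sub => u [Zu|/=]; first by apply: sub_acl; right; left; left.
  rewrite xsE mem_cat inE orbCA => /orP[/eqP->|h].
    apply: aclS xz => w [[Zw|/= w1]|->]; [by left; left| |by left; right].
    by right; rewrite /= mem_cat w1.
  by apply: sub_acl; right; right; rewrite /= mem_cat.
have sub2 : acl (Z' `|` [set` xs']) `<=` acl (Z `|` [set` xs]).
  apply: acl_sub => u [[Zu|->//]|/= h]; first by apply: sub_acl; right; left.
  by apply: sub_acl; right; right; move: h; rewrite /= xsE !mem_cat inE => /orP[]->; rewrite ?orbT.
have E2 : Z' `|` [set` ys] = Z `|` [set` ys] `|` [set z] by rewrite setUAC.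
have [|||szle IHe] := IH Z' xs' uys.
- move=> u uys' [Zu|/= uz]; first by apply: nZ Zu; rewrite inE uys' orbT.
  by apply: nTz; right; rewrite /= -uz.
- by rewrite E2.
- move=> u uys'; have := yxs u; rewrite inE uys' orbT => /(_ isT).
  by apply: v_closureS; exact: sub1.
have szE : size xs = (size xs').+1 by rewrite xsE !size_cat addnS.
split=> [|]; first by rewrite szE ltnS.
rewrite szE /= => -[] /IHe[ys' [[sz' ys'e] ys'xs xs'ys iso]].
have E3 : Z `|` [set` z :: ys'] = Z' `|` [set` ys'].
  rewrite -setUA; congr (_ `|` _); apply/seteqP; split=> w /=; rewrite inE.
    by case/orP => [/eqP|]; [left|right].
  by move=> [->|->]; rewrite ?eqxx ?orbT.
exists (z :: ys'); split.
- by split; [rewrite /= sz'|case=> [|i] //= ilt; exact: ys'e].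
- move=> u /=; rewrite inE => /orP[/eqP->//|h]; apply: sub2; exact: ys'xs.
- rewrite E3 => u h.
  have : acl (Z' `|` [set` xs']) u by apply: sub1; apply: sub_acl; right; right.
  apply: acl_sub => w [Zw|/xs'ys//]; apply: sub_acl; right; left; exact: Zw.
- rewrite E3; apply: isometric_over_trans iso _; rewrite E2.
  exact: isometric_over_close.
Qed.

Lemma indep_size ys xs : uniq ys -> cl_indep K [set` ys] ->
  [set` ys] `<=` cl [set` xs] -> (size ys <= size xs)%N.
Proof.
move=> uys iys yx.
have [|||//] := @exchange_perturb ys set0 xs 1 ltr01 uys; first by move=> y _ [].
  by rewrite set0U.
by move=> y /yx; rewrite set0U.
Qed.

(** Discard repetitions and elements in the closure of the others, by induction on the length. *)
Lemma indep_generators xs : exists ys, [/\ uniq ys, cl_indep K [set` ys],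
  {subset ys <= xs} & cl [set` ys] = cl [set` xs]].
Proof.
have [n] := ubnP (size xs); elim: n xs => // n IH xs; rewrite ltnS => szxs.
have [[uxs ixs]|dep] := pselect (uniq xs /\ cl_indep K [set` xs]); first by exists xs; split.
suff [zs [szz zsx xsz]] : exists zs, [/\ (size zs < size xs)%N, {subset zs <= xs} &
    [set` xs] `<=` cl [set` zs]].
  have [ys [uys iys yz yE]] := IH zs (leq_trans szz szxs).
  exists ys; split => //; first by move=> y /yz /zsx.
  rewrite yE; apply/seteqP; split; last exact: cl_sub.
  by apply: clS => y /zsx.
have [uxs|nuxs] := boolP (uniq xs); last first.
  exists (undup xs); split; first by rewrite ltn_size_undup.
    by move=> y; rewrite mem_undup.
  by move=> y yx; apply: gen_sub_cl; rewrite /= mem_undup.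
have [x xxs xcl] : exists2 x, x \in xs & cl ([set` xs] `\ x) x.
  apply: contrapT => h; apply: dep; split => // x xxs xcl; apply: h.
  by exists x.
have sub : [set` xs] `\ x `<=` [set` rem x xs].
  by move=> y [/= yxs yx]; rewrite mem_rem_uniq// inE yxs andbT; exact/eqP.
exists (rem x xs); split.
- by rewrite size_rem// prednK//; case: (xs) xxs.
- exact: mem_rem.
- move=> y yxs; have [->|yx] := eqVneq y x; first exact: clS sub _ xcl.
  by apply: gen_sub_cl; apply: sub; split => //; exact/eqP.
Qed.

End SteinitzExchange.

(** * Orthogonality *)

Section RealBounds.
Variable R : realType.
Implicit Types (x y s t : R).

Lemma small_power t x : 0 <= t < 1 -> 0 < x -> exists n, t ^+ n < x.
Proof.
move=> /andP[t0 t1] x0; apply: contrapT => h.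
have : 1 <= t; last by rewrite leNgt t1.
apply: (@le_of_power_bound _ _ _ x^-1) => // n.
rewrite expr1n mulrC ler_pdivlMr// mul1r leNgt; apply/negP => tn.
by apply: h; exists n.
Qed.

Lemma le_of_shrink x y : 0 <= y -> (forall t, 0 < t < 1 -> t * x <= y) -> x <= y.
Proof.
move=> y0 h; rewrite leNgt; apply/negP => yx.
have x0 : 0 < x by apply: le_lt_trans yx.
pose t := (x + y) / (2 * x).
have t01 : 0 < t < 1.
  by rewrite divr_gt0 ?mulr_gt0 ?ltr0n//= ?ltr_pdivrMr ?mulr_gt0 ?ltr0n//; lra.
have := h t t01.
have -> : t * x = (x + y) / 2 by rewrite /t; field; rewrite gt_eqF.
by lra.
Qed.

Lemma le_of_power_dilate D s t : 0 <= t ->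
  (forall c, 1 < c -> s <= c ^+ D * t) -> s <= t.
Proof.
move=> t0 h; rewrite leNgt; apply/negP => ts.
have s0 : 0 < s by apply: le_lt_trans ts.
(* By Bernoulli, (1 - d)^D >= 1 - D d > t / s, which contradicts the hypothesis at c = 1 / (1 -
   d). *)
pose d : R := (1 - t / s) / 2 / D.+1%:R.
have D0 : 0 < D.+1%:R :> R by rewrite ltr0n.
have q1 : t / s < 1 by rewrite ltr_pdivrMr// mul1r.
have q0 : 0 <= t / s by rewrite divr_ge0// ltW.
have d0 : 0 < d by rewrite !divr_gt0 ?ltr0n// subr_gt0.
have dD : d * D.+1%:R = (1 - t / s) / 2.
  by rewrite /d divfK ?gt_eqF.
have d1 : d < 1.
  have : d <= d * D.+1%:R by rewrite ler_peMr ?(ltW d0)// ler1n.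
  by rewrite dD; lra.
have bern n : 1 - n%:R * d <= (1 - d) ^+ n.
  elim: n => [|n IH]; first by rewrite mul0r subr0 expr0.
  rewrite exprS; apply: (@le_trans _ _ ((1 - d) * (1 - n%:R * d))); last first.
    by rewrite ler_wpM2l// subr_ge0 ltW.
  have n0 : 0 <= n%:R * d ^+ 2 :> R by rewrite mulr_ge0 ?ler0n ?exprn_ge0 ?ltW.
  by rewrite -natr1; nra.
have pos : 0 < (1 - d) ^+ D by rewrite exprn_gt0// subr_gt0.
have := h (1 - d)^-1; rewrite invf_gt1 ?subr_gt0// => /(_ ltac:(lra)).
rewrite exprVn mulrC ler_pdivlMr// leNgt => /negP; apply.
have -> : t = s * (t / s) by field; rewrite gt_eqF.
rewrite ltr_pM2l//; apply: lt_le_trans (bern D).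
have : D%:R * d <= (1 - t / s) / 2.
  by rewrite -dD mulrC ler_pM2l// ler_nat leqnSn.
by lra.
Qed.

End RealBounds.

Section ValueGroup.
Variables (R : realType) (L : acfield R).
Implicit Types (x y z a b c : L) (r s t : R).
Local Notation v := (@absv R L).

(** For large n, an n-th root q of p has r / s < |q| < 1. The powers of q, starting above s,
    decrease by a ratio too mild to jump over the interval from s to r. *)
Lemma value_dense p r s : 0 < v p < 1 -> 0 < r -> r < s ->
  exists c : L, r < v c < s.
Proof.
move=> /andP[p0 p1] r0 rs.
have s0 : 0 < s by exact: lt_trans rs.
have [|n np] := @small_power _ (r / s) (v p) _ p0.
  by rewrite divr_ge0 ?ltW//= ltr_pdivrMr// mul1r.
have n0 : (0 < n)%N.
  by rewrite lt0n; apply: contraTneq np => ->; rewrite expr0 -leNgt ltW.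
have [|q] := @poly_root _ L ('X^n - p%:P).
  by rewrite size_XnsubC// ltnS.
rewrite /root hornerD hornerN hornerXn hornerC subr_eq0 => /eqP qp.
have vq : v q ^+ n = v p by rewrite -vX qp.
have rq : r / s < v q.
  by rewrite -(ltr_pXn2r n0) ?nnegrE ?v_ge0 ?divr_ge0 ?ltW// vq.
have q1 : v q < 1.
  by rewrite -(ltr_pXn2r n0) ?nnegrE ?v_ge0 ?ler01// vq expr1n.
have q0 : 0 < v q by apply: lt_trans rq; exact: divr_gt0.
have q01 : 0 <= v q < 1 by rewrite v_ge0.
have [|N NP] := @small_power _ _ s^-1 q01; first by rewrite invr_gt0.
pose u j := v (q ^- N * q ^+ j).
have uE j : u j = v q ^+ j / v q ^+ N by rewrite /u vM vV !vX mulrC.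
have qN : 0 < v q ^+ N by exact: exprn_gt0.
have ex : exists j, u j < s.
  have [j jP] := small_power q01 (mulr_gt0 s0 qN).
  by exists j; rewrite uE ltr_pdivrMr.
case: (ex_minnP ex) => -[|j] us jmin.
  move: us; rewrite uE expr0 mul1r => us; exfalso.
  have : s < (v q ^+ N)^-1 by rewrite invf_pgt ?posrE.
  by rewrite ltNge ltW.
exists (q ^- N * q ^+ j.+1); apply/andP; split => //.
have : s <= u j by rewrite leNgt; apply/negP => /jmin; rewrite ltnn.
rewrite uE => su; rewrite -/(u j.+1) uE exprS -mulrA.
by apply: lt_le_trans (ler_wpM2l (ltW q0) su); rewrite -ltr_pdivrMr.
Qed.

Lemma value_avoid p (rs : seq R) r s : 0 < v p < 1 -> 0 < r -> r < s ->
  exists2 c : L, r < v c < s & v c \notin rs.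
Proof.
move=> vp r0; elim: rs s => [|t rs IH] s rs'.
  by have [c cP] := value_dense vp r0 rs'; exists c.
have [tr|rt] := leP t r.
  have [c /andP[c1 c2] cn] := IH s rs'; exists c; first by rewrite c1.
  by rewrite inE negb_or cn andbT gt_eqF// (le_lt_trans tr).
have [ts|st] := leP s t.
  have [c /andP[c1 c2] cn] := IH s rs'; exists c; first by rewrite c1.
  by rewrite inE negb_or cn andbT lt_eqF// (lt_le_trans c2).
have [c /andP[c1 c2] cn] := IH t rt; exists c; first by rewrite c1 (lt_trans c2).
by rewrite inE negb_or cn andbT lt_eqF.
Qed.

End ValueGroup.

Section Domination.
Variables (R : realType) (L : acfield R).
Implicit Types (x y z a b e : L) (c r s t : R) (w : nat -> L).
Local Notation v := (@absv R L).

(* [F] and the vectors [w] are orthogonal over [E]: the distances of each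
   vector to the spans of the previous ones over [E] and over [F] agree. *)
Definition span_orthogonal (E F : set L) w := forall k t, 0 < t < 1 ->
  exists2 u, lspan E w k u &
    forall u', lspan F w k u' -> t * v (w k - u) <= v (w k - u').

Variables (E F : set L) (w : nat -> L).
Hypotheses (aE : ac_subfield E) (sF : subfield F) (EF : E `<=` F).
Hypothesis wEF : span_orthogonal E F w.

Let sE : subfield E. Proof. by have [] := aE. Qed.

(** The roots of f lie in E, so each of its at most D linear factors contributes at most a factor
    c. *)
Lemma horner_dominated c a e D f : 1 <= c ->
  (forall g, E g -> v (e - g) <= c * v (a - g)) ->
  coefs_in E f -> (size f <= D.+1)%N -> v f.[e] <= c ^+ D * v f.[a].
Proof.
move=> c1 ea fE szf; have c0 : 0 <= c by apply: le_trans c1.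
have [->|f0] := eqVneq f 0; first by rewrite !horner0 v0 mulr0.
have [rs frs] := poly_split f.
have rsE x : x \in rs -> E x.
  move=> trs; have [_ _ algE] := aE; apply: algE.
  exists f; split => //; first exact/(polyOver_coefs _ sE).
  by rewrite frs rootZ ?lead_coef_eq0// root_prod_XsubC.
have szrs : (size rs <= D)%N.
  by move: szf; rewrite frs size_scale ?lead_coef_eq0// size_prod_XsubC.
apply: (@le_trans _ _ (c ^+ size rs * v f.[a])); last first.
  by rewrite ler_wpM2r ?v_ge0//; exact: ler_weXn2l.
rewrite frs !hornerZ !vM mulrCA ler_wpM2l ?v_ge0//.
elim: rs rsE {frs szrs} => [|t rs IH] rsE.
  by rewrite big_nil expr0 mul1r !hornerC.
rewrite big_cons !hornerM !vM !hornerXsubC /= exprS mulrACA.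
apply: ler_pM; rewrite ?v_ge0//; first by apply: ea; apply: rsE; rewrite mem_head.
by apply: IH => u us; apply: rsE; rewrite inE us orbT.
Qed.

(** Induction on k: replace w_k by its error w_k - u, with u nearly best over E, and absorb u into
    the lower coefficients. As u is nearly best over F too, the value at a of the sum is at least t
    times that of either part; both parts are dominated, and t tends to 1. *)
Lemma span_dominated c a e D k (G : nat -> {poly L}) : 1 <= c -> F a ->
  (forall g, E g -> v (e - g) <= c * v (a - g)) ->
  (forall i, coefs_in E (G i)) -> (forall i, (i < k)%N -> (size (G i) <= D.+1)%N) ->
  v (\sum_(i < k) w i * (G i).[e]) <= c ^+ D * v (\sum_(i < k) w i * (G i).[a]).
Proof.
move=> c1 Fa ea; have c0 : 0 <= c by apply: le_trans c1.
elim: k G => [|k IH] G GE szG; first by rewrite !big_ord0 v0 mulr0.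
apply: le_of_shrink => [|t t01]; first by rewrite mulr_ge0 ?v_ge0 ?exprn_ge0.
have [u [d dE uE] uP] := wEF k t01.
have /andP[t0 t1] := t01.
pose H i := G i + d i *: G k.
have HE i : coefs_in E (H i).
  by apply: (coefs_inD sE) => //; exact: (coefs_inZ sE).
have szH i : (i < k)%N -> (size (H i) <= D.+1)%N.
  move=> ik; apply: leq_trans (size_polyD _ _) _; rewrite geq_max szG ?(ltnW ik)//=.
    by apply: leq_trans (size_scale_leq _ _) _; exact: szG.
  exact: leqW.
have zE y : \sum_(i < k.+1) w i * (G i).[y] =
    \sum_(i < k) w i * (H i).[y] + (w k - u) * (G k).[y].
  rewrite big_ord_recr /= uE mulrBl mulr_suml addrCA -[in RHS]addrCA addrC.
  rewrite [RHS]addrC -addrA; congr (_ + _).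
  rewrite addrC -sumrB; apply: eq_bigr => i _.
  by rewrite hornerD hornerZ; ring.
have hs := IH H HE szH.
have ht : v ((w k - u) * (G k).[e]) <= c ^+ D * v ((w k - u) * (G k).[a]).
  rewrite !vM mulrCA ler_wpM2l ?v_ge0//; apply: horner_dominated => //.
  exact: szG.
rewrite !zE; set se := \sum_(i < k) _ in hs *; set sa := \sum_(i < k) _ in hs *.
set te := (w k - u) * _ in ht *; set ta := (w k - u) * _ in ht *.
have lt : t * v ta <= v (sa + ta).
  have [Ga0|Ga0] := eqVneq (G k).[a] 0.
    by rewrite /ta Ga0 mulr0 v0 mulr0 v_ge0.
  have -> : sa + ta = (G k).[a] * (w k - (u - sa / (G k).[a])) by rewrite /ta; field.
  rewrite /ta !vM mulrA [t * _]mulrC [v (G k).[a] * _]mulrC ler_wpM2r ?v_ge0//.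
    rewrite mulrC; apply: uP; apply: (lspanB sF).
      by rewrite uE; exists d => // i; exact: EF.
    rewrite mulrC; apply: (lspanZ sF).
      apply: (sfV sF); apply: (sf_horner sF) => // i; exact/EF/GE.
    exists (fun i => (H i).[a]).
      by move=> i; apply: (sf_horner sF) => // j; exact/EF/HE.
    by apply: eq_bigr => i _; rewrite mulrC.
have ls : t * v sa <= v (sa + ta).
  rewrite -{1}(addrK ta sa).
  have := vD_max (sa + ta) (- ta); rewrite vN le_max => /orP[h|h].
    by apply: le_trans (ler_wpM2l (ltW t0) h) _; rewrite ler_piMl ?v_ge0 ?ltW.
  exact: le_trans (ler_wpM2l (ltW t0) h) lt.
have cD : 0 <= c ^+ D by rewrite exprn_ge0.
have := vD_max se te; rewrite le_max => /orP[h|h].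
  apply: le_trans (ler_wpM2l (ltW t0) (le_trans h hs)) _.
  by rewrite mulrCA ler_wpM2l.
apply: le_trans (ler_wpM2l (ltW t0) (le_trans h ht)) _.
by rewrite mulrCA ler_wpM2l.
Qed.

(* If [v (a - b) < s], then P is larger at a generic point [e] at distance slightly
   more than [s] from [a] than at [a], against [span_dominated]. *)
Lemma orthogonal_distance a b s k (G : nat -> {poly L}) : F a -> 0 < s ->
  (forall g, E g -> s <= v (a - g)) -> (forall i, coefs_in E (G i)) ->
  \sum_(i < k) w i *: G i != 0 -> root (\sum_(i < k) w i *: G i) b ->
  s <= v (a - b).
Proof.
move=> Fa s0 sa GE P0 Pb; rewrite leNgt; apply/negP => ab.
set P := \sum_(i < k) _ in P0 Pb.
pose D := \max_(i < k) size (G i).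
have szG i : (i < k)%N -> (size (G i) <= D.+1)%N.
  by move=> ik; apply: leqW; exact: (leq_bigmax (Ordinal ik)).
have Pdom c e : 1 <= c -> (forall g, E g -> v (e - g) <= c * v (a - g)) ->
    v P.[e] <= c ^+ D * v P.[a].
  move=> c1 ea; have := span_dominated c1 Fa ea GE szG.
  by rewrite !horner_sum; under eq_bigr do rewrite -hornerZ;
    under [X in _ * v X]eq_bigr do rewrite -hornerZ.
have sza : s <= v a by rewrite -[a]subr0; apply: sa; exact: sf0.
(* If the absolute value of [L] is trivial, then [a = b] and P vanishes on [L]. *)
have [[p vp]|triv] := pselect (exists p : L, 0 < v p < 1); last first.
  have v1_ x : x != 0 -> v x = 1.
    move=> x0; apply: contrapT => /eqP; rewrite neq_lt => /orP[x1|x1]; apply: triv.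
      by exists x; rewrite v_gt0 x0.
    by exists x^-1; rewrite vV invr_gt0 v_gt0 x0 invf_lt1// v_gt0.
  have vle1 x : v x <= 1.
    by have [->|/v1_->//] := eqVneq x 0; rewrite v0.
  have abE : a = b.
    apply/eqP; rewrite -subr_eq0; apply: contraTT ab => /v1_ ->.
    by rewrite -leNgt (le_trans sza).
  have Pe e : P.[e] = 0.
    apply/eqP; rewrite -v_eq0 eq_le v_ge0 andbT.
    have := Pdom 1 e (lexx _); rewrite abE (rootP Pb) v0 mulr0; apply => g Eg.
    rewrite mul1r -abE [leRHS]v1_//; rewrite -v_gt0.
    exact: lt_le_trans (sa g Eg).
  have szP := root_size_gt1 P0 Pb.
  have [|x] := @poly_root _ L (P + 1); first by rewrite size_polyDl// size_poly1.
  by rewrite /root hornerD Pe add0r hornerC oner_eq0.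
have [Q PQ] := factor_theorem _ _ Pb.
have Q0 : Q != 0 by apply: contraNneq P0 => Q0; rewrite PQ Q0 mul0r.
have [rs Qrs] := poly_split Q.
have lQ : 0 < v (lead_coef Q) by rewrite v_gt0 lead_coef_eq0.
have : s <= v (a - b); last by rewrite leNgt ab.
apply: (@le_of_power_dilate _ D) => [|c c1]; first exact: v_ge0.
have ssc : s < c * s by rewrite ltr_pMl.
(* For each root x of Q, |d| differs from |a - x|, so |e - x| is the larger of the two; hence |Q(a)|
   <= |Q(e)|, while |e - b| = |d| > s. Domination then gives s <= c^D |a - b|, and c tends to 1. *)
have [d /andP[sd dc] dn] := value_avoid [seq v (a - x) | x <- rs] vp s0 ssc.
pose e := a + d.
have ea g : E g -> v (e - g) <= c * v (a - g).
  move=> Eg; rewrite /e addrAC; apply: vD_le.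
    by rewrite ler_peMl ?v_ge0// ltW.
  apply: le_trans (ltW dc) _; rewrite ler_wpM2l ?sa// ltW//.
  exact: lt_trans c1.
have := Pdom c e (ltW c1) ea.
rewrite PQ !hornerM !hornerXsubC !vM.
have eb : v (e - b) = v d.
  by rewrite /e addrAC vD_dom// (lt_trans ab).
have er (r : L) : r \in rs -> v (a - r) <= v (e - r) /\ 0 < v (e - r).
  move=> rrs; have : v d != v (a - r).
    by apply: contraNneq dn => ->; exact: (map_f (fun x => v (a - x))).
  rewrite /e addrAC neq_lt => /orP[h|h].
    by rewrite [_ + d]addrC (vD_dom h) lexx (le_lt_trans _ h)// v_ge0.
  by rewrite (vD_dom h) (ltW h) (lt_trans s0).
have [Qae Qe] : v Q.[a] <= v Q.[e] /\ 0 < v Q.[e].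
  rewrite Qrs !hornerZ !vM ler_pM2l// mulr_gt0//.
    split=> //; elim: rs er {Qrs dn} => [|r rs IH] er; first by rewrite big_nil !hornerC.
    rewrite big_cons !hornerM !vM !hornerXsubC.
    apply: ler_pM; rewrite ?v_ge0//; first by apply: (er r _).1; rewrite mem_head.
    by apply: IH => r' r's; apply: er; rewrite inE r's orbT.
  elim: rs er {Qrs dn} => [|r rs IH] er; first by rewrite big_nil hornerC v1.
  rewrite big_cons hornerM vM hornerXsubC mulr_gt0//.
    by apply: (er r _).2; rewrite mem_head.
  by apply: IH => r' r's; apply: er; rewrite inE r's orbT.
rewrite eb => h; rewrite -(ler_pM2l Qe).
apply: (@le_trans _ _ (v Q.[e] * v d)); first by rewrite ler_wpM2l ?ltW.
apply: le_trans h _; rewrite [leRHS]mulrCA ler_wpM2l ?exprn_ge0//.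
  by apply: le_trans (ltW c1); rewrite ler01.
by rewrite ler_wpM2r ?v_ge0.
Qed.

End Domination.

(** * Generators of intermediate fields *)

Section CountableGeneration.
Variables (R : realType) (L : acfield R) (K : set L).
Implicit Types (x y a b : L) (r s t : R) (w : nat -> L) (us xs : seq L).
Local Notation v := (@absv R L).
Local Notation cl S := (ta_closure v K S).
Local Notation acl S := (alg_closure (adjoin K S)).

(** Otherwise every approximation could be improved by the factor t, and iterating would go below
    the positive distance from w_k to the closed span. *)
Lemma best_approximation (F : set L) w k t : subfield F -> v_closure v F `<=` F ->
  0 < t < 1 -> exists2 u, lspan F w k u &
    forall u', lspan F w k u' -> t * v (w k - u) <= v (w k - u').
Proof.
move=> sF vF /andP[t0 t1].
have [wk|wk] := pselect (lspan F w k (w k)).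
  by exists (w k) => // u' _; rewrite subrr v0 mulr0 v_ge0.
have [d d0 dk] := dist_gt0 (@lspan_closed _ _ _ sF vF w k) wk.
apply: contrapT => h.
have step u : lspan F w k u -> exists2 u', lspan F w k u' & v (w k - u') < t * v (w k - u).
  move=> ku; apply: contrapT => h'; apply: h; exists u => // u' ku'.
  by rewrite leNgt; apply/negP => lt; apply: h'; exists u'.
have iter n : exists2 u, lspan F w k u & v (w k - u) <= t ^+ n * v (w k).
  elim: n => [|n [u ku un]].
    by exists 0; [exact: lspan0|rewrite subr0 expr0 mul1r].
  have [u' ku' uu'] := step u ku; exists u' => //.
  by rewrite exprS -mulrA; apply: le_trans (ltW uu') _; rewrite ler_pM2l.
have wk0 : 0 < v (w k) by rewrite -[w k]subr0; apply: lt_le_trans (dk _ (lspan0 _ sF _)).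
have [|n tn] := @small_power _ t (d / v (w k)) _ (divr_gt0 d0 wk0).
  by rewrite t1 ltW.
have [u ku un] := iter n.
have := le_trans (dk u ku) un; rewrite leNgt => /negP; apply.
by rewrite -ltr_pdivlMr.
Qed.

(* [z] lists the coefficients of almost best approximations of each [w k]. *)
Lemma countable_orthogonal (F : set L) w : ac_subfield F -> K `<=` F ->
  exists2 z : nat -> L, forall n, F (z n) & span_orthogonal (cl (range z)) F w.
Proof.
move=> [sF vF aF] KF.
(* The countably many factors 1 - 1/(m+2) suffice, as they tend to 1; the shift by 2 keeps them
   positive. *)
have t01 m : 0 < (1 - m.+2%:R^-1 : R) < 1.
  by rewrite subr_gt0 invf_lt1 ?ltr0n// ltr1n/= ltrBlDr ltrDl invr_gt0 ltr0n.
have /choice[c cP] (km : nat * nat) : exists c : nat -> L, (forall i, F (c i)) /\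
    forall u', lspan F w km.1 u' -> (1 - km.2.+2%:R^-1) *
      v (w km.1 - \sum_(i < km.1) c i * w i) <= v (w km.1 - u').
  by have [_ [c cF ->] cP] := best_approximation w km.1 sF vF (t01 km.2); exists c.
pose z n := if unpickle n is Some (k, m, i) then c (k, m) i else 0.
exists z.
  move=> n; rewrite /z; case: (unpickle n) => [[[k m] i]|]; last exact: sf0.
  by have [] := cP (k, m).
move=> k t /andP[t0 t1].
have [m mt] : exists m, t <= 1 - m.+2%:R^-1 :> R.
  have [|m mP] := @inv_succ_small _ (1 - t); first by rewrite subr_gt0.
  by exists m; rewrite lerBrDr -lerBrDl ltW// mP// leqnSn.
exists (\sum_(i < k) c (k, m) i * w i).
  exists (c (k, m)) => // i; apply: gen_sub_cl; exists (pickle (k, m, i)) => //.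
  by rewrite /z pickleK.
move=> u' /(cP (k, m)).2; apply: le_trans.
by rewrite ler_wpM2r ?v_ge0.
Qed.

Definition monomial us (e : seq nat) := \prod_(j < size us) us`_j ^+ nth 0%N e j.

(** An enumeration of all monomials, with repetitions; an n that codes no exponent list gives the
    monomial 1. *)
Definition nth_monomial us n := monomial us (odflt [::] (unpickle n)).

Lemma nth_monomial_mul us i j : exists k,
  nth_monomial us i * nth_monomial us j = nth_monomial us k.
Proof.
pose e := odflt [::] (unpickle i) : seq nat.
pose f := odflt [::] (unpickle j) : seq nat.
exists (pickle (mkseq (fun l => nth 0 e l + nth 0 f l)%N (size us))).
rewrite /nth_monomial pickleK /= /monomial -big_split; apply: eq_bigr => l _.
by rewrite nth_mkseq// exprD.
Qed.

Lemma nth_monomial_one us : exists i, nth_monomial us i = 1.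
Proof.
exists (pickle ([::] : seq nat)); rewrite /nth_monomial pickleK /=.
by rewrite /monomial big1// => i _; rewrite nth_nil expr0.
Qed.

Lemma nth_monomial_gen us x : x \in us -> exists i, nth_monomial us i = x.
Proof.
move=> xus; have ixus : (index x us < size us)%N by rewrite index_mem.
exists (pickle (mkseq (fun l => (l == index x us) : nat) (size us))).
rewrite /nth_monomial pickleK /= /monomial (bigD1 (Ordinal ixus))//=.
rewrite nth_mkseq// eqxx expr1 nth_index// big1 ?mulr1// => i ix.
rewrite nth_mkseq// (_ : _ == _ = false) ?expr0//.
by apply: contraNF ix => /eqP ix; apply/eqP/val_inj.
Qed.

Lemma acl_rep us b : subfield K -> acl [set` us] b ->
  exists k (G : nat -> {poly L}), [/\ forall i, coefs_in K (G i),
    \sum_(i < k) nth_monomial us i *: G i != 0 &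
    root (\sum_(i < k) nth_monomial us i *: G i) b].
Proof.
move=> sK; apply: alg_adjoin_rep => //; first exact: nth_monomial_mul.
  exact: nth_monomial_one.
by move=> x /nth_monomial_gen.
Qed.

(** If a in F had distance at least s > 0 from the field generated by the coefficients z, it would
    by [orthogonal_distance] stay at distance s from everything algebraic over K(xs); but such
    elements approximate a. *)
Lemma countably_generated (F : set L) xs : subfield K -> K `<=` F -> ac_subfield F ->
  F `<=` cl [set` xs] -> exists2 z : nat -> L, forall n, F (z n) & F = cl (range z).
Proof.
move=> sK KF aF Fxs; have [sF _ _] := aF.
have [z Fz orth] := countable_orthogonal (nth_monomial xs) aF KF.
have EF : cl (range z) `<=` F by apply: cl_min => // _ [n _ <-].
exists z => //; apply/seteqP; split => // a Fa; apply: contrapT => nEa.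
have [_ vE _] := cl_ac_subfield K (range z).
have [s s0 sa] := dist_gt0 vE nEa.
have [b bxs ab] := Fxs a Fa s s0.
have [k [G [GK P0 Pb]]] := acl_rep sK bxs.
have : s <= v (a - b); last by rewrite leNgt ab.
apply: (orthogonal_distance (cl_ac_subfield K _) sF EF orth Fa s0 sa _ P0 Pb).
by move=> i j; apply: base_sub_cl; exact: GK.
Qed.

End CountableGeneration.

(** * Continuity of algebraic elements in the generators *)

Section ContinuityOfRoots.
Variables (R : realType) (L : acfield R) (K : set L).
Hypothesis sK : subfield K.
Implicit Types (x y a b p : L) (r e d : R) (us : seq L).
Local Notation v := (@absv R L).
Local Notation cl S := (ta_closure v K S).
Local Notation acl S := (alg_closure (adjoin K S)).

Definition near_seq e us us' := size us' = size us /\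
  forall i, (i < size us)%N -> v (us`_i - us'`_i) < e.

Lemma near_seq_refl e us : 0 < e -> near_seq e us us.
Proof. by move=> e0; split => // i _; rewrite subrr v0. Qed.

Lemma near_seq_le e d us us' : e <= d -> near_seq e us us' -> near_seq d us us'.
Proof. by move=> ed [sz uu']; split=> // i /uu' h; exact: lt_le_trans ed. Qed.

Lemma near_seq_trans e us us' us'' :
  near_seq e us us' -> near_seq e us' us'' -> near_seq e us us''.
Proof.
move=> [sz uu'] [sz' uu'']; split=> [|i ius]; first by rewrite sz'.
by apply: vB_trans_lt (uu' i ius) _; apply: uu''; rewrite sz.
Qed.

Definition continuous_at us (f : seq L -> L) := forall e, 0 < e ->
  exists2 d, 0 < d & forall us', near_seq d us us' -> v (f us' - f us) < e.

Lemma continuous_at_const us x : continuous_at us (fun=> x).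
Proof. by move=> e e0; exists 1 => // us' _; rewrite subrr v0. Qed.

Lemma continuous_at_nth us i : (i < size us)%N -> continuous_at us (fun s => s`_i).
Proof. by move=> ius e e0; exists e => // us' [_ /(_ i ius)]; rewrite vBC. Qed.

Lemma continuous_atD us f g : continuous_at us f -> continuous_at us g ->
  continuous_at us (fun s => f s + g s).
Proof.
move=> cf cg e e0; have [d d0 df] := cf e e0; have [d' d'0 dg] := cg e e0.
exists (Num.min d d'); first by rewrite lt_min d0.
move=> us' near; have -> : f us' + g us' - (f us + g us) =
  (f us' - f us) + (g us' - g us) by ring.
apply: vD_lt; [apply: df|apply: dg]; apply: near_seq_le near; rewrite ge_min lexx//.
by rewrite orbT.
Qed.

Lemma continuous_atM us f g : continuous_at us f -> continuous_at us g ->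
  continuous_at us (fun s => f s * g s).
Proof.
move=> cf cg e e0.
pose M := Num.max 1 (Num.max (v (f us)) (v (g us))).
have M1 : 1 <= M by rewrite le_max lexx.
have M0 : 0 < M by exact: lt_le_trans M1.
have fM : v (f us) <= M by rewrite !le_max lexx orbT.
have gM : v (g us) <= M by rewrite !le_max lexx !orbT.
pose m := Num.min 1 (e / M).
have m0 : 0 < m by rewrite lt_min ltr01 divr_gt0.
have mM : m * M <= e by rewrite -ler_pdivlMr// ge_min lexx orbT.
have m1 : m <= M by apply: le_trans M1; rewrite ge_min lexx.
have [d d0 df] := cf m m0; have [d' d'0 dg] := cg m m0.
exists (Num.min d d'); first by rewrite lt_min d0.
move=> us' near.
have {}df : v (f us' - f us) < m.
  by apply: df; apply: near_seq_le near; rewrite ge_min lexx.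
have {}dg : v (g us' - g us) < m.
  by apply: dg; apply: near_seq_le near; rewrite ge_min lexx orbT.
have -> : f us' * g us' - f us * g us =
  (f us' - f us) * g us' + f us * (g us' - g us) by ring.
have gM' : v (g us') <= M.
  by rewrite -[g us'](subrK (g us)); apply: vD_le => //; apply: le_trans m1; exact: ltW.
apply: lt_le_trans mM; apply: vD_lt; rewrite vM.
  by apply: le_lt_trans (ler_wpM2l (v_ge0 _) gM') _; rewrite ltr_pM2r.
by rewrite mulrC; apply: le_lt_trans (ler_wpM2l (v_ge0 _) fM) _; rewrite ltr_pM2r.
Qed.

Lemma continuous_atX us f n : continuous_at us f -> continuous_at us (fun s => f s ^+ n).
Proof.
move=> cf; elim: n => [|n IH]; first exact: continuous_at_const.
have := continuous_atM cf IH.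
by move=> h e /h[d d0 dP]; exists d => // s /dP; rewrite !exprS.
Qed.

Lemma continuous_at_sum us n (f : nat -> seq L -> L) :
  (forall i, continuous_at us (f i)) -> continuous_at us (fun s => \sum_(i < n) f i s).
Proof.
move=> cf; elim: n => [|n IH] e e0.
  by exists 1 => // us' _; rewrite !big_ord0 subrr v0.
have [d d0 dP] := continuous_atD IH (cf n) e0.
by exists d => // us' /dP; rewrite !big_ord_recr.
Qed.

Lemma continuous_at_prod us n (f : nat -> seq L -> L) :
  (forall i, (i < n)%N -> continuous_at us (f i)) ->
  continuous_at us (fun s => \prod_(i < n) f i s).
Proof.
elim: n => [|n IH] cf e e0.
  by exists 1 => // us' _; rewrite !big_ord0 subrr v0.
have [d d0 dP] := continuous_atM (IH (fun i h => cf i (ltnW h))) (cf n (leqnn _)) e0.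
by exists d => // us' /dP; rewrite !big_ord_recr.
Qed.

Lemma continuous_at_monomial us i : continuous_at us (fun s => nth_monomial s i).
Proof.
move=> e e0.
have [|d d0 dP] := @continuous_at_prod us (size us)
  (fun j s => s`_j ^+ nth 0%N (odflt [::] (unpickle i)) j) _ e e0.
  by move=> j jus; apply: continuous_atX; exact: continuous_at_nth.
exists d => // us' near; have := dP us' near.
by rewrite /nth_monomial /monomial; case: near => ->.
Qed.

(** The coefficients c_j of the equation, recentred at p, are continuous in the generators. At us,
    c_0 vanishes and some c_j does not, so nearby |c_0| < |c_j| (d/2)^j and [coef_small_root] gives
    a root within d/2 of p, hence strictly within d. *)
Lemma acl_continuous us p d : acl [set` us] p -> 0 < d ->
  exists2 e, 0 < e & forall us', near_seq e us us' ->
    exists2 p', acl [set` us'] p' & v (p - p') < d.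
Proof.
move=> /(acl_rep sK)[k [G [GK P0 Pp]]] d0.
pose P s := \sum_(i < k) nth_monomial s i *: G i.
pose c j s := \sum_(i < k) nth_monomial s i * (G i \Po ('X + p%:P))`_j.
have cE j s : (P s \Po ('X + p%:P))`_j = c j s.
  rewrite /P linear_sum coef_sum; apply: eq_bigr => i _.
  by rewrite linearZ coefZ.
have cc j : continuous_at us (c j).
  apply: (@continuous_at_sum us k (fun i s => nth_monomial s i * (G i \Po ('X + p%:P))`_j)).
  move=> i; apply: continuous_atM; last exact: continuous_at_const.
  exact: continuous_at_monomial.
have c0 : c 0%N us = 0.
  by rewrite -cE -horner_coef0 horner_comp hornerD hornerX hornerC add0r (rootP Pp).
have [j cj] : exists j, c j us != 0.
  have : P us \Po ('X + p%:P) != 0 by rewrite comp_poly2_eq0// size_XaddC.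
  move=> Q0; exists (size (P us \Po ('X + p%:P))).-1.
  by rewrite -cE -lead_coefE lead_coef_eq0.
have j0 : (0 < j)%N by rewrite lt0n; apply: contra_neq cj => ->.
have d20 : 0 < d / 2 by rewrite divr_gt0.
have vcj : 0 < v (c j us) by rewrite v_gt0.
have [e1 e10 e1P] := cc j _ vcj.
have [e2 e20 e2P] := cc 0%N _ (mulr_gt0 vcj (exprn_gt0 j d20)).
exists (Num.min e1 e2); first by rewrite lt_min e10.
move=> us' near.
have vj : v (c j us') = v (c j us).
  rewrite -[c j us'](subrK (c j us)) vD_dom//; apply: e1P.
  by apply: near_seq_le near; rewrite ge_min lexx.
have v0' : v (c 0%N us') < v (c j us) * (d / 2) ^+ j.
  rewrite -[c 0%N us']subr0 -c0; apply: e2P.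
  by apply: near_seq_le near; rewrite ge_min lexx orbT.
have [||t Pt td] := @coef_small_root _ _ (P us' \Po ('X + p%:P)) (d / 2) j (ltW d20) j0.
- by rewrite cE -v_eq0 vj gt_eqF.
- by rewrite !cE vj ltW.
exists (p + t); last first.
  by rewrite opprD addrA subrr add0r vN (le_lt_trans td)//; lra.
have sA := adjoin_subfield K [set` us'].
exists (P us'); split.
- apply/(polyOver_coefs _ sA); apply: (coefs_in_sum sA) => i _.
  apply: (coefs_inZ sA).
    rewrite /nth_monomial /monomial; apply: big_ind => [|x y|l _]; first exact: (sf1 sA).
      exact: (sfM sA).
    by apply: (sfX sA); apply: sub_adjoin; right; exact: mem_nth.
  by move=> l; apply: sub_adjoin; left; exact: GK.
- apply: contraTneq vcj => Pu0.
  by rewrite -vj -cE Pu0 comp_poly0 coef0 v0 ltxx.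
- by move: Pt; rewrite /root horner_comp hornerD hornerX hornerC addrC.
Qed.

Lemma cl_continuous us d (ps : seq L) : 0 < d -> (forall p, p \in ps -> cl [set` us] p) ->
  exists2 e, 0 < e & forall us', near_seq e us us' -> forall p, p \in ps ->
    exists2 p', acl [set` us'] p' & v (p - p') < d.
Proof.
move=> d0; elim: ps => [|p ps IH] psu; first by exists 1.
have [|e e0 eP] := IH; first by move=> q qps; apply: psu; rewrite inE qps orbT.
have [p0 p0u pp0] := psu p (mem_head _ _) d d0.
have [e' e'0 e'P] := acl_continuous p0u d0.
exists (Num.min e e'); first by rewrite lt_min e0.
move=> us' near q; rewrite inE => /orP[/eqP->|qps].
  have [|p' p'u p0p'] := e'P us'.
    by apply: near_seq_le near; rewrite ge_min lexx orbT.
  by exists p' => //; exact: vB_trans_lt pp0 p0p'.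
by apply: eP => //; apply: near_seq_le near; rewrite ge_min lexx.
Qed.

End ContinuityOfRoots.

Section FiniteGeneration.
Variables (R : realType) (L : acfield R) (K : set L).
Hypothesis sK : subfield K.
Implicit Types (x y a b p : L) (r e d : R) (us ys : seq L).
Local Notation v := (@absv R L).
Local Notation cl S := (ta_closure v K S).
Local Notation acl S := (alg_closure (adjoin K S)).

Lemma cl_base_eq S T : S `<=` acl T -> T `<=` acl S -> cl S = cl T.
Proof. by move=> ST TS; apply/seteqP; split; exact: cl_acl. Qed.

(** Independent generators extracted from us are at least as many as the ys, so nothing was
    discarded. *)
Lemma generators_indep us ys : uniq ys -> cl_indep K [set` ys] ->
  [set` ys] `<=` cl [set` us] -> size us = size ys -> uniq us /\ cl_indep K [set` us].
Proof.
move=> uys iys yu sz.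
have [zs [uzs izs zu zE]] := indep_generators K us.
have szz : (size us <= size zs)%N by rewrite sz; apply: (indep_size uys iys); rewrite zE.
split; first exact: leq_size_uniq uzs zu szz.
rewrite (_ : [set` us] = [set` zs])//.
have [_ zsu] := uniq_min_size uzs zu szz.
by apply/seteqP; split=> x /=; rewrite zsu.
Qed.

Variables (F : set L) (n : nat).
Hypotheses (aF : ac_subfield F) (KF : K `<=` F).
Hypothesis n_max : forall ys, uniq ys -> cl_indep K [set` ys] -> (size ys <= n)%N.

Definition transcendence_base us :=
  [/\ size us = n, uniq us, cl_indep K [set` us] & [set` us] `<=` F].

(** Independent generators zs extracted from a :: us number exactly n, by maximality. Exchange then
    moves us slightly to a list us' with the same algebraic closure over K as zs. *)
Lemma transcendence_base_step us a e : transcendence_base us -> F a -> 0 < e -> exists us',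
  [/\ transcendence_base us', near_seq e us us', [set` us] `<=` cl [set` us'] & cl [set` us'] a].
Proof.
move=> [szu uus ius usF] Fa e0.
have [zs [uzs izs zsu zE]] := indep_generators K (a :: us).
have uz : [set` us] `<=` cl [set` zs].
  by rewrite zE => x xus; apply: gen_sub_cl; rewrite /= inE; apply/orP; right.
have az : cl [set` zs] a by rewrite zE; apply: gen_sub_cl; rewrite /= mem_head.
have szz : size us = size zs.
  by apply/eqP; rewrite eqn_leq (indep_size uus ius uz) szu n_max.
have [|||_ /(_ szz)[us' [[szu' near] u'z zu' _]]] :=
    @exchange_perturb _ _ K us set0 zs e e0 uus; rewrite ?set0U//.
  by move=> y _ [].
rewrite !set0U in u'z zu'.
have clE : cl [set` us'] = cl [set` zs] by exact: cl_base_eq.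
have [uu' iu'] : uniq us' /\ cl_indep K [set` us'].
  by apply: generators_indep uus ius _ _; rewrite ?clE.
exists us'; split; rewrite ?clE//.
- split => //; first by rewrite szu'.
  move=> x xu'; have : cl [set` zs] x by apply: acl_sub_cl; exact: u'z.
  rewrite zE; apply: cl_min => // y /=; rewrite inE => /orP[/eqP->//|].
  exact: usF.
Qed.

(* Bases of an increasing sequence of subfields with dense union, each one chosen
   so near the previous ones that the limit [us] stays in all the balls on which
   continuity of roots keeps the [z j] close to the algebraic closure of K(us). *)
Lemma finitely_generated ys (z : nat -> L) : transcendence_base ys -> F = cl (range z) ->
  exists us, [/\ size us = n, [set` us] `<=` F & cl [set` us] = F].
Proof.
move=> bys FE; have [sF vF algF] := aF.
have Fz k : F (z k) by rewrite FE; apply: gen_sub_cl; exists k.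
(* A stage is a base together with a radius: all later stages, and the limit, stay within that
   radius of it. *)
pose st := (seq L * R)%type.
pose inv k (s : st) := [/\ transcendence_base s.1, 0 < s.2 & forall j, (j < k)%N -> cl [set` s.1] (z j)].
pose next k (s s' : st) := [/\ inv k.+1 s', near_seq s.2 s.1 s'.1,
  s'.2 <= s.2, s'.2 <= k.+1%:R^-1 & forall us, near_seq s'.2 s'.1 us ->
    forall j, (j <= k)%N -> exists2 p, acl [set` us] p & v (z j - p) < k.+1%:R^-1].
have step (ks : nat * st) : exists s', inv ks.1 ks.2 -> next ks.1 ks.2 s'.
  case: ks => k [us e] /=.
  have [[/= bus e0 zus]|ninv] := pselect (inv k (us, e)); last by exists (us, e).
  have [us' [bus' near uu' zku']] := transcendence_base_step bus (Fz k) e0.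
  have zj j : (j < k.+1)%N -> cl [set` us'] (z j).
    rewrite ltnS leq_eqVlt => /orP[/eqP->//|/zus zju].
    by apply: cl_sub zju.
  have [|d d0 dP] := @cl_continuous _ _ K sK us' k.+1%:R^-1 (mkseq z k.+1) (inv_succ_gt0 R k).
    by move=> p /mapP[j]; rewrite mem_iota /= => jk ->; exact: zj.
  exists (us', Num.min d (Num.min e k.+1%:R^-1)) => _; split => //=.
  - by split => //=; rewrite !lt_min d0 e0 inv_succ_gt0.
  - by rewrite !ge_min lexx !orbT.
  - by rewrite !ge_min lexx !orbT.
  - move=> us'' near'' j jk; apply: (dP us'').
      by apply: near_seq_le near''; rewrite ge_min lexx.
    by apply/mapP; exists j => //; rewrite mem_iota.
have [nxt nxtP] := choice step.
pose S k : st := iteri k (fun i s => nxt (i, s)) (ys, 1).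
have Sinv k : inv k (S k).
  elim: k => [|k IH]; first by split=> //=; exact: ltr01.
  by have [] := nxtP (k, S k) IH.
have Snext k : next k (S k) (S k.+1) by apply: (nxtP (k, S k)); exact: Sinv.
have Sle k m : (S (k + m)%N).2 <= (S k).2.
  elim: m => [|m IH]; first by rewrite addn0.
  by rewrite addnS; have [_ _ h _ _] := Snext (k + m)%N; exact: le_trans IH.
have Snear k m : near_seq (S k).2 (S k).1 (S (k + m)%N).1.
  elim: m => [|m IH]; first by rewrite addn0; apply: near_seq_refl; have [] := Sinv k.
  rewrite addnS; apply: near_seq_trans IH _.
  by apply: near_seq_le (Sle k m) _; have [] := Snext (k + m)%N.
have Ssize k : size (S k).1 = n by have [[]] := Sinv k.
have Ssmall e : 0 < e -> exists N, forall k, (N <= k)%N -> (S k.+1).2 < e.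
  move=> /inv_succ_small[N NP]; exists N => k Nk.
  by have [_ _ _ h _] := Snext k; exact: le_lt_trans h (NP k Nk).
have /choice[l lP] i : exists l, (i < n)%N -> F l /\
    forall e, 0 < e -> exists N, forall k, (N <= k)%N -> v ((S k).1`_i - l) < e.
  have [ilt|_] := ltnP i n; last by exists 0.
  have SF k : F (S k).1`_i.
    by have [[szk _ _ kF] _ _] := Sinv k; apply: kF => /=; rewrite mem_nth ?szk.
  have [|l Fl lP] := (ac_subfield_analytic aF).2 (fun k => (S k).1`_i) SF; last by exists l.
  move=> e /Ssmall[N NP]; exists N.+1 => p q Np Nq.
  have near m : (N.+1 <= m)%N -> v ((S N.+1).1`_i - (S m).1`_i) < e.
    move=> Nm; rewrite -(subnKC Nm); have [_ h] := Snear N.+1 (m - N.+1)%N.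
    by apply: lt_trans (h i _) (NP N (leqnn _)); rewrite Ssize.
  by apply: vB_trans_lt (near q Nq); rewrite vBC; exact: near.
pose us := mkseq l n.
have szus : size us = n by rewrite size_mkseq.
(* Strictness survives the passage to the limit: by the ultrametric inequality open balls are
   closed. *)
have Sus k : near_seq (S k).2 (S k).1 us.
  split=> [|i]; first by rewrite szus Ssize.
  rewrite Ssize => ilt; rewrite nth_mkseq//.
  have [_ k0 _] := Sinv k; have [N NP] := (lP i ilt).2 _ k0.
  apply: (@vB_trans_lt _ _ _ (S (k + N)%N).1`_i).
    by have [_ h] := Snear k N; apply: h; rewrite Ssize.
  by apply: NP; rewrite leq_addl.
have usF : [set` us] `<=` F.
  by move=> x /= /mapP[i]; rewrite mem_iota /= => ilt ->; have [] := lP i ilt.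
exists us; split => //; apply/seteqP; split; first exact: cl_min.
rewrite [X in X `<=` _]FE; apply: cl_sub => _ [j _ <-] e e0.
have [N NP] := inv_succ_small e0; pose k := maxn N j.
have [_ _ _ _ h] := Snext k.
have [|p pus zp] := h us (Sus k.+1) j; first by rewrite leq_maxr.
by exists p => //; apply: lt_trans zp (NP _ _); rewrite leq_maxl.
Qed.

End FiniteGeneration.

(** * Immediacy of the extension *)

Section Immediate.
Variables (R : realType) (L : acfield R) (K F : set L).
Implicit Types (u c : L) (ys : seq L).
Local Notation v := (@absv R L).
Local Notation cl S := (ta_closure v K S).
Hypotheses (aF : ac_subfield F) (KF : K `<=` F).

Let sF : subfield F. Proof. by have [] := aF. Qed.

(** Over F, 0 is already a best approximation of u^k: a monic polynomial of degree k over F splits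
    over F, and each factor at u has value at least |u|. *)
Lemma span_orthogonal_power (E : set L) u : subfield E ->
  (forall c, F c -> v u <= v (u - c)) -> span_orthogonal E F (fun i => u ^+ i).
Proof.
move=> sE uF k t /andP[t0 t1]; exists 0; first exact: lspan0.
move=> _ [c cF ->]; rewrite subr0.
apply: (@le_trans _ _ (v (u ^+ k))); first by rewrite ler_piMl ?v_ge0 ?ltW.
pose p : {poly L} := 'X^k - \poly_(i < k) c i.
have -> : u ^+ k - \sum_(i < k) c i * u ^+ i = p.[u].
  by rewrite /p hornerD hornerN hornerXn horner_poly.
have szp : size p = k.+1.
  by rewrite size_polyDl size_polyXn// size_polyN ltnS size_poly.
have pm : p \is monic.
  by rewrite monicE lead_coefE szp coefB coefXn eqxx coef_poly ltnn subr0.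
have pF : coefs_in F p.
  apply: (coefs_inB sF) => i; first by rewrite coefXn; case: eqP => _; [exact: sf1|exact: sf0].
  by rewrite coef_poly; case: ifP => _ //; exact: sf0.
have [rs prs] := poly_split p; rewrite (monicP pm) scale1r in prs.
have szrs : size rs = k.
  by apply: succn_inj; rewrite -szp prs size_prod_XsubC.
have rsF r : r \in rs -> F r.
  move=> rrs; have [_ _ algF] := aF; apply: algF.
  exists p; split; [exact/(polyOver_coefs _ sF)|by rewrite monic_neq0|].
  by rewrite prs root_prod_XsubC.
rewrite vX -szrs prs; elim: rs rsF {prs szrs} => [|r rs IH] rsF.
  by rewrite big_nil hornerC v1 expr0.
rewrite big_cons hornerM vM hornerXsubC exprS; apply: ler_pM; rewrite ?v_ge0 ?exprn_ge0 ?v_ge0//.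
  by apply: uF; apply: rsF; rewrite mem_head.
by apply: IH => x xrs; apply: rsF; rewrite inE xrs orbT.
Qed.

(** Otherwise u :: ys would be independent: u is outside F, which contains cl ys, and a dependence
    of some a in ys would place elements algebraic over E(u) too near to a, against
    [orthogonal_distance]. *)
Lemma approximation_in_base ys u : uniq ys -> cl_indep K [set` ys] -> [set` ys] `<=` F ->
  ~ (exists us, [/\ uniq us, cl_indep K [set` us] & size us = (size ys).+1]) ->
  u != 0 -> exists2 c, F c & v (u - c) < v u.
Proof.
move=> uys iys ysF maxy u0; apply: contrapT => h.
have uF c : F c -> v u <= v (u - c).
  by move=> Fc; rewrite leNgt; apply/negP => lt; apply: h; exists c.
have nFu : ~ F u.
  by move=> /uF; rewrite subrr v0 leNgt v_gt0 u0.
have uys' : u \notin ys by apply: contra_notN nFu => /ysF.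
apply: maxy; exists (u :: ys); split; rewrite /= ?uys'//.
move=> a; rewrite /= inE => /orP[/eqP-> ucl|ays acl_].
  apply: nFu; apply: cl_min ucl => // x [/=]; rewrite inE => /orP[/eqP->//|/ysF//].
pose E := cl ([set` ys] `\ a).
have aE : ac_subfield E by exact: cl_ac_subfield.
have [sE vE _] := aE.
have EF : E `<=` F by apply: cl_min => // x [/ysF].
have nEa : ~ E a by exact: iys.
have [s s0 sa] := dist_gt0 vE nEa.
have sub : [set` u :: ys] `\ a `<=` ([set` ys] `\ a) `|` [set u].
  by move=> x [/=]; rewrite inE => /orP[/eqP->|xys] xa; [right|left].
have [b bu ab] := clS sub acl_ s0; rewrite -adjoin_adjoin in bu.
have {}bu : alg_closure (adjoin E [set u]) b.
  apply: alg_closureS bu; apply: adjoin_min; first exact: adjoin_subfield.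
    move=> x xE; apply: sub_adjoin; left; apply: acl_sub_cl; apply: sub_alg_closure xE.
    exact: adjoin_subfield.
  by move=> x ->; apply: sub_adjoin; right.
have [k [G [GE P0 Pb]]] := alg_adjoin1_rep sE bu.
have : s <= v (a - b); last by rewrite leNgt ab.
exact: (orthogonal_distance aE sF EF (span_orthogonal_power sE uF) (ysF _ ays) s0 sa GE P0 Pb).
Qed.

Lemma immediate_of_approximation :
  (forall u, u != 0 -> exists2 c, F c & v (u - c) < v u) ->
  immediate_ext v F [set: L].
Proof.
move=> happ.
(* A strict approximation forces |c| = |u|, and when |u| <= 1 also equality of residue classes; u =
   0 is approximated by itself. *)
have app u : exists2 c, F c & (u != 0 -> v (u - c) < v u) /\ v c = v u.
  have [->|u0] := eqVneq u 0; first by exists 0; [exact: sf0|].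
  have [c Fc uc] := happ u u0; exists c => //; split => //.
  by rewrite -[c](subKr u) vB_dom.
split.
  apply/seteqP; split=> B; last by case=> x [Fx x1] <-; exists x.
  case=> x [_ x1] <-; have [c Fc [xc vc]] := app x.
  exists c; first by split; [exact: Fc|rewrite /= vc].
  have xc1 : v (x - c) < 1.
    have [x0|x0] := eqVneq x 0; last exact: lt_le_trans (xc x0) x1.
    by rewrite x0 sub0r vN vc x0 v0 ltr01.
  apply/seteqP; split=> y /= yx.
    by apply: vB_trans_lt yx _; rewrite vBC.
  exact: vB_trans_lt yx xc1.
apply/seteqP; split=> r; last by case=> x [Fx x0] <-; exists x.
case=> x [_ /eqP x0] <-; have [c Fc [xc vc]] := app x.
by exists c => //; split => //; apply/eqP; rewrite -(v_eq0 (L := L)) vc v_eq0.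
Qed.

End Immediate.

(** * Topological transcendence degrees *)

Section Cardinality.
Variable T : choiceType.
Implicit Types (A B : set T) (s : seq T).

Lemma uniq_seq_card s : uniq s -> [set` s] #= `I_(size s).
Proof.
move=> us; rewrite (_ : [set` s] = [set` [fset x in s]%fset]).
  by apply/card_eq_fsetP; rewrite card_fseq undup_id.
by apply/seteqP; split=> x /=; rewrite inE.
Qed.

Lemma seq_card_le s s' : uniq s -> uniq s' ->
  ([set` s] #<= [set` s']) = (size s <= size s')%N.
Proof.
move=> us us'.
by rewrite (card_le_eql (uniq_seq_card us)) (card_le_eqr (uniq_seq_card us')) card_le_II.
Qed.

(** Reduces a cardinal bound to finite lists: an infinite A would contain a list longer than s. *)
Lemma card_le_seq A s :
  (forall s', uniq s' -> [set` s'] `<=` A -> (size s' <= size s)%N) ->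
  uniq s -> A #<= [set` s].
Proof.
move=> As us.
have [/finite_seqP[s0 AE]|/(infinite_set_fset (size s).+1)[B BA]] := pselect (finite_set A);
  last by rewrite ltnNge As// fset_uniq.
have E : A = [set` undup s0] by rewrite AE; apply/seteqP; split=> x /=; rewrite mem_undup.
by rewrite E seq_card_le ?undup_uniq// As ?undup_uniq// E.
Qed.

End Cardinality.

Section Main.
Variables (R : realType) (L : acfield R).
Implicit Types (K F S : set L) (xs ys us : seq L).
Local Notation v := (@absv R L).

Lemma isometric_over_isomorphic K S T : isometric_over K S T ->
  analytic_isomorphic v K S T.
Proof.
move=> [G [iG <- <- GK]].
pose f x := xget 0 [set y | G (x, y)].
have fG x : dom G x -> G (x, f x).
  by move=> [y Gxy]; exact: (@xgetI _ 0 [set y | G (x, y)] y Gxy).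
have fE x y : G (x, y) -> f x = y.
  by move=> Gxy; apply: (ir_fun iG (fG x _) Gxy); exists y.
exists f; split.
- split.
  + by move=> x /fG Gx; exists x.
  + move=> x y /set_mem/fG Gx /set_mem/fG Gy fxy; apply/eqP.
    by rewrite -subr_eq0; have /= -> := ir_eq0 iG (irB iG Gx Gy); rewrite fxy subrr.
  + by move=> y [x Gxy]; exists x; [exists y|exact: fE].
- by move=> x y /set_mem/fG Gx /set_mem/fG Gy; exact: (fE _ _ (irD iG Gx Gy)).
- by move=> x y /set_mem/fG Gx /set_mem/fG Gy; exact: (fE _ _ (irM iG Gx Gy)).
- by move=> k /set_mem /GK /fE.
- by move=> x /set_mem /fG /(irv iG).
Qed.

Lemma isomorphism_isometry K S T f : ac_subfield S -> ac_subfield T ->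
  set_bij S T f -> {in S &, {morph f : x y / x + y}} ->
  {in S &, {morph f : x y / x * y}} -> {in S, forall x, v (f x) = v x} ->
  ac_isometry [set p | S p.1 /\ p.2 = f p.1].
Proof.
move=> aS aT [fST finj fsurj] fD fM fv; have [sS _ _] := aS.
have S1 := sf1 sS.
have f0 x : S x -> f x = 0 -> x = 0.
  by move=> Sx fx0; apply/eqP; rewrite -(v_eq0 (L := L)) -fv ?fx0 ?v0//; exact/mem_set.
split.
- split.
  (* That f(1) = 1 is not part of [analytic_isomorphic]; it follows from f(1)^2 = f(1) and f(1) !=
     0. *)
  + split=> //=; have f1 : f 1 != 0.
      by apply/eqP => /(f0 _ S1) /eqP; rewrite oner_eq0.
    by apply: (mulfI f1); rewrite mulr1 -fM ?mulr1//; exact/mem_set.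
  + move=> [x x'] [y y'] [/= Sx ->] [/= Sy ->]; split; first exact: (sfB sS).
    apply: (addIr (f y)); rewrite /= subrK -fD ?subrK//; apply/mem_set => //.
    exact: (sfB sS).
  + move=> [x x'] [y y'] [/= Sx ->] [/= Sy ->]; split; first exact: (sfM sS).
    by rewrite /= fM//; exact/mem_set.
  + by move=> [x x'] [/= Sx ->]; rewrite fv//; exact/mem_set.
- rewrite (_ : dom _ = S)//; apply/seteqP; split=> [x [y []//]|x Sx].
  by exists (f x).
- rewrite (_ : dom _ = T)//; apply/seteqP; split=> [y [x [/= Sx ->]]|y /fsurj[x Sx <-]].
    exact: fST.
  by exists x.
Qed.

(** The image of an independent set is independent, as the inverse isometry carries any dependence
    back. *)
Lemma isomorphic_card_le K F : ac_subfield F -> analytic_isomorphic v K [set: L] F ->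
  top_tr_degree v K [set: L] #<= top_tr_degree v K F.
Proof.
move=> aF [f [fbij fD fM fK fv]].
have aG := isomorphism_isometry K (ac_subfieldT L) aF fbij fD fM fv.
have [fST finj _] := fbij.
apply: (card_supP _).2 => S [_ iS].
apply: (@card_le_trans _ _ _ (f @` S)).
  by rewrite (card_le_eqr (inj_card_eq _))// => x y _ _; apply: finj; exact: mem_set.
apply: (card_supP _).1; split; first by move=> _ [x _ <-]; exact: fST.
apply/cl_indepP => _ [x Sx <-] fx; move/cl_indepP : iS => /(_ x Sx); apply.
apply: (ac_isometry_cl (ac_isometry_transpose aG) _ _ _ fx) => //.
  by move=> k Kk; split=> //=; rewrite fK//; exact/mem_set.
move=> _ [[y Sy <-] yx]; exists y => //; split=> // yxE.
by apply: yx; rewrite /= yxE.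
Qed.

Variables (K F : set L).
Hypotheses (aK : ac_subfield K) (aF : ac_subfield F) (KF : K `<=` F).
Local Notation cl S := (ta_closure v K S).

(** The set representing Tr.c(L/K) is itself generating, since the minimum is attained; being
    finite, it can be thinned out to an independent one. *)
Lemma small_basis : small_ext v K [set: L] ->
  exists xs, [/\ uniq xs, cl_indep K [set` xs] & cl [set` xs] = [set: L]].
Proof.
have full : completed_alg_closure v [set: L] = [set: L].
  apply/seteqP; split => // x _; apply: sub_v_closure; apply: sub_alg_closure => //.
  by have [] := ac_subfieldT L.
rewrite /small_ext => /finite_seqP[s sE].
have [|[_ sgen] _] := @card_minP _ [set S | ta_generating v K [set: L] S].
  exists [set: L]; split => //; rewrite full; apply/seteqP; split => // x _.
  exact: gen_sub_cl.
rewrite -[card_min _]/(top_gen_degree v K [set: L]) sE full in sgen.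
by have [xs [uxs ixs _ xsE]] := indep_generators K s; exists xs; rewrite xsE -sgen.
Qed.

Variable xs : seq L.
Hypotheses (uxs : uniq xs) (ixs : cl_indep K [set` xs]) (xsE : cl [set` xs] = [set: L]).

Let n_max ys : uniq ys -> cl_indep K [set` ys] -> (size ys <= size xs)%N.
Proof. by move=> uys iys; apply: (indep_size uys iys); rewrite xsE. Qed.

(** Otherwise all independent lists in F are shorter than xs, and tr.c(F/K) is less than the size of
    xs, which is a lower bound of tr.c(L/K). *)
Lemma equal_degree_basis : top_tr_degree v K F #= top_tr_degree v K [set: L] ->
  exists ys, [/\ size ys = size xs, uniq ys, cl_indep K [set` ys] & [set` ys] `<=` F].
Proof.
move=> trE; apply: contrapT => h.
have small ys : uniq ys -> cl_indep K [set` ys] -> [set` ys] `<=` F ->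
    (size ys < size xs)%N.
  move=> uys iys ysF; rewrite ltnNge; apply/negP => szy; apply: h.
  have tk : [set` take (size xs) ys] `<=` [set` ys] by move=> x /=; exact: mem_take.
  exists (take (size xs) ys); split; first by rewrite size_takel.
  - exact: take_uniq.
  - exact: cl_indep_sub tk iys.
  - by move=> x /tk/ysF.
have n0 : (0 < size xs)%N.
  by apply: (small [::]) => // x; rewrite /= in_nil.
(* Only the cardinality of zs matters: it represents the bound as a subset of L. The empty list,
   being independent in F, ensures that xs is nonempty. *)
pose zs := take (size xs).-1 xs.
have szz : size zs = (size xs).-1 by rewrite size_takel// leq_pred.
have trF : top_tr_degree v K F #<= [set` zs].
  apply: (card_supP _).2 => S [SF /cl_indepP iS].
  apply: card_le_seq; last exact: take_uniq.
  move=> s us sS; rewrite szz -ltnS prednK//.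
  by apply: small => //; [exact: cl_indep_sub sS iS|move=> x /sS/SF].
have xtr : [set` xs] #<= top_tr_degree v K [set: L].
  by apply: (card_supP _).1; split => //; exact/cl_indepP.
have : [set` xs] #<= [set` zs].
  apply: card_le_trans xtr _.
  by rewrite -(card_le_eql trE).
by rewrite seq_card_le ?take_uniq// szz leqNgt prednK// leqnn.
Qed.

(** F has as many generators us as xs has elements, and they are independent. Exchange against xs,
    with an arbitrary radius, moves them to generators us' of L with cl us' isometric to cl us =
    F. *)
Lemma equal_degree_isomorphic ys : size ys = size xs -> uniq ys ->
  cl_indep K [set` ys] -> [set` ys] `<=` F -> analytic_isomorphic v K [set: L] F.
Proof.
move=> szy uys iys ysF; have [sK _ _] := aK.
have [|z _ FE] := countably_generated (xs := xs) sK KF aF; first by rewrite xsE.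
have [us [szu usF usE]] :=
  finitely_generated sK aF KF n_max (And4 szy uys iys ysF) FE.
have [||uus ius] := @generators_indep _ _ K us ys uys iys; rewrite ?usE ?szu//.
have [|||_] := @exchange_perturb _ _ K us set0 xs 1 ltr01 uus; rewrite ?set0U ?xsE//.
  by move=> y _ [].
move=> /(_ szu)[us' [_ _ xsu iso]]; apply: isometric_over_isomorphic.
move: iso xsu; rewrite !set0U usE => iso xsu.
rewrite -[[set: L]](_ : cl [set` us'] = _)//.
by apply/seteqP; split => //; rewrite -xsE; exact: cl_acl.
Qed.

Lemma equal_degree_immediate ys : size ys = size xs -> uniq ys ->
  cl_indep K [set` ys] -> [set` ys] `<=` F -> immediate_ext v F [set: L].
Proof.
move=> szy uys iys ysF; apply: immediate_of_approximation => // u u0.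
apply: (approximation_in_base aF KF uys iys ysF) u0.
move=> [us [uus ius szu]].
by have := n_max uus ius; rewrite szu szy ltnn.
Qed.

End Main.

Theorem theorem2p3p4 (R : realType) (L : fieldType) (v : L -> R)
    (K F : set L)
    (v_absval : nonarch_absval v)
    (L_complete : analytic v [set: L]) (L_closed : alg_closed [set: L])
    (K_analytic : analytic v K) (K_closed : alg_closed K)
    (F_analytic : analytic v F) (F_closed : alg_closed F)
    (KF : K `<=` F)
    (LK_small : small_ext v K [set: L]) :
  [/\ top_tr_degree v K F #<= top_tr_degree v K [set: L],
      analytic_isomorphic v K [set: L] F <->
        top_tr_degree v K F #= top_tr_degree v K [set: L] &
      top_tr_degree v K F #= top_tr_degree v K [set: L] ->
        immediate_ext v F [set: L]].
Proof.
pose M := ACField v_absval L_complete.2 L_closed.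
have aK := analytic_ac_subfield (L := M) K_analytic K_closed.
have aF := analytic_ac_subfield (L := M) F_analytic F_closed.
have le_tr : top_tr_degree v K F #<= top_tr_degree v K [set: L].
  apply: (card_supP _).2 => S [SF iS].
  by apply: (card_supP _).1; split.
have [xs [uxs ixs xsE]] := small_basis (L := M) LK_small.
split => //; last first.
  move=> /(equal_degree_basis (L := M) uxs ixs)[ys [szy uys iys ysF]].
  exact: (equal_degree_immediate (L := M) aF KF xsE szy uys iys ysF).
split=> [iso|].
  by rewrite card_eq_le le_tr; exact: (isomorphic_card_le (L := M) aF iso).
move=> /(equal_degree_basis (L := M) uxs ixs)[ys [szy uys iys ysF]].
exact: (equal_degree_isomorphic (L := M) aK aF KF xsE szy uys iys ysF).
Qed.
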